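(* For every compact $K\subset\mathbb{C}$, as $N\to\infty$, $$\frac1N\sum_{k=0}^{N-1}\mathrm{Spec}_{h_k}\mathcal{W}(z)\to 1\quad\text{almost surely in } C(K)$$ (i.e. uniformly in $z\in K$, almost surely).
   Context: Hermite functions: $h_n(t)=\frac{2^{1/4}}{\sqrt{n!}}\left(\frac{-1}{2\sqrt\pi}\right)^n e^{\pi t^2}\frac{d^n}{dt^n}\left(e^{-2\pi t^2}\right)$, $n\ge 0$, an orthonormal basis of $L^2(\mathbb{R})$. Complex white noise $\mathcal{W}$ is the random tempered distribution on $\mathbb{R}$ with $\mathbb{E}[e^{i\,\mathrm{Re}\langle \mathcal{W},\phi\rangle}]=e^{-\frac14\|\phi\|_{L^2(\mathbb{R})}^2}$ for all Schwartz $\phi$; equivalently $\mathcal{W}=\sum_{k\ge 0}\zeta_k h_k$ (convergence in $\mathcal{S}'(\mathbb{R})$) with $\zeta_k$ i.i.d. standard complex Gaussian $N_{\mathbb{C}}(0,1)$ (density $\pi^{-1}e^{-|\zeta|^2}$). For a Schwartz window $g$, the short-time Fourier transform of a function $f$ is $V_gf(x,\xi)=\int_{\mathbb{R}} f(t)\overline{g(t-x)}e^{-2\pi i\xi t}\,dt$, extended to tempered distributions by applying $f$ to $t\mapsto \overline{g(t-x)}e^{-2\pi i\xi t}$; thus $V_{h_n}\mathcal{W}=\sum_k\zeta_kV_{h_n}h_k$. The spectrogram is $\mathrm{Spec}_{g}f(z)=|V_gf(x,\xi)|^2$ with $z=x+i\xi\in\mathbb{C}$. $C(K)$ is the space of continuous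 functions on $K$ with the sup norm. *)

(* Defs.v *)
From HB Require Import structures.
From mathcomp Require Export all_boot all_order all_algebra.
From mathcomp Require Export complex.
From mathcomp Require Export all_classical all_reals all_analysis.

Set Implicit Arguments.
Unset Strict Implicit.
Unset Printing Implicit Defensive.

Export Order.TTheory GRing.Theory Num.Theory.
Export numFieldNormedType.Exports.

#[global] Open Scope classical_set_scope.
#[global] Open Scope ring_scope.
#[global] Open Scope complex_scope.

(* Complex numbers are R[i]; Normc.normc is the R-valued modulus. *)

Definition expi {R : realType} (a : R) : R[i] := cos a +i* sin a.

(* R[i] is not registered as a normed module over R, so functions R -> R[i] are
   differentiated componentwise. *)
Definition cderive1n {R : realType} (n : nat) (f : R -> R[i]) (t : R) : R[i] :=
  derive1n n (fun s => complex.Re (f s)) t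
  +i* derive1n n (fun s => complex.Im (f s)) t.

Definition csmooth {R : realType} (f : R -> R[i]) : Prop :=
  forall (n : nat) (t : R),
    derivable (derive1n n (fun s => complex.Re (f s))) t 1 /\
    derivable (derive1n n (fun s => complex.Im (f s))) t 1.

Definition schwartz {R : realType} (f : R -> R[i]) : Prop :=
  csmooth f /\
  forall j k : nat, exists C : R, forall t : R,
    `|t| ^+ j * Normc.normc (cderive1n k f t) <= C.

Definition schwartz_seminorm {R : realType} (j k : nat) (f : R -> R[i]) : R :=
  sup (range (fun t : R => `|t| ^+ j * Normc.normc (cderive1n k f t))).

(* The carrier is total; only its values on Schwartz functions are meaningful.
   Linearity is over the complex numbers, so the pairing is bilinear, and
   continuity is for the topology generated by the Schwartz seminorms. *)
Record tempered_distribution (R : realType) := TemperedDistribution {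
  pairing :> (R -> R[i]) -> R[i];
  pairing_linear : forall (a : R[i]) (phi psi : R -> R[i]),
    schwartz phi -> schwartz psi ->
    pairing (fun t => a * phi t + psi t) = a * pairing phi + pairing psi;
  pairing_continuous : forall phi : R -> R[i], schwartz phi ->
    forall e : R, 0 < e -> exists (m : nat) (d : R), 0 < d /\
      forall psi : R -> R[i], schwartz psi ->
        (forall j k : nat, (j <= m)%N -> (k <= m)%N ->
           schwartz_seminorm j k (fun t => psi t - phi t) < d) ->
        Normc.normc (pairing psi - pairing phi) < e }.

Definition L2norm {R : realType} (f : R -> R[i]) : R :=
  fine (Lnorm (@lebesgue_measure R) 2%:E (fun t => (Normc.normc (f t))%:E)).

Definition cexpectation {d : measure_display} {T : measurableType d}
    {R : realType} (P : probability T R) (X : T -> R[i]) : R[i] :=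
  fine (expectation P (fun w => complex.Re (X w)))
  +i* fine (expectation P (fun w => complex.Im (X w))).

Definition complex_white_noise {d : measure_display} {T : measurableType d}
    {R : realType} (P : probability T R)
    (W : T -> tempered_distribution R) : Prop :=
  forall phi : R -> R[i], schwartz phi ->
    [/\ measurable_fun [set: T] (fun w => complex.Re (W w phi)),
        measurable_fun [set: T] (fun w => complex.Im (W w phi)) &
        cexpectation P (fun w => expi (complex.Re (W w phi)))
          = (expR (- (4^-1 * L2norm phi ^+ 2)))%:C].

Definition hermite {R : realType} (n : nat) (t : R) : R :=
  2 `^ (4^-1) / Num.sqrt (n`!%:R) * (- 1 / (2 * Num.sqrt pi)) ^+ n
  * expR (pi * t ^+ 2)
  * derive1n n (fun s : R => expR (- (2 * pi * s ^+ 2))) t.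

Definition hermitec {R : realType} (n : nat) (t : R) : R[i] := (hermite n t)%:C.

Definition stft {R : realType} (g : R -> R[i]) (u : tempered_distribution R)
    (x xi : R) : R[i] :=
  u (fun t => (g (t - x))^* * expi (- (2 * pi * xi * t))).

Definition spectrogram {R : realType} (g : R -> R[i])
    (u : tempered_distribution R) (z : R[i]) : R :=
  Normc.normc (stft g u (complex.Re z) (complex.Im z)) ^+ 2.

(* Main.v *)
(* Write X_k(z) = V_{h_k}W(z).  Along a ray s -> s z the ladder relations of the
   Hermite functions give X_k' = a sqrt(k) X_{k-1} - conj(a) sqrt(k+1) X_{k+1}
   + i b X_k with b real, so that d/ds of the sum of |X_k|^2 over k < n
   telescopes to a boundary term of size O(sqrt(n) (|X_{n-1}|^2 + |X_n|^2)).
   Summing over a window n, ..., n + L - 1 turns the boundary terms into another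
   partial sum, at the cost of a factor sqrt(n)/L.  As W is tempered, |X_k|^2
   grows polynomially in k; with L = n each use lowers the exponent by 1/2 until
   the partial sums are O(n), and then L = o(n) with sqrt(n) = o(L) shows that
   the averages at z and at 0 have the same limit, uniformly for bounded z.  At
   z = 0 the X_k are standard complex Gaussians, and it remains to prove a
   strong law for the squares of their real and imaginary parts Y_k.  Only the
   characteristic functional is available, so Y^2 is compared with
   (sin(tY)/t)^2 <= Y^2, whose first two moments are expectations of cosines,
   with t tending to 0 along the subsequence of sixth powers. *)
Require Import Defs.
From mathcomp Require Import measurable_realfun zify ring lra.

Set Implicit Arguments.
Unset Strict Implicit.
Unset Printing Implicit Defensive.

(** * Hermite functions *)

(** The statement asks for one null set serving an uncountable family of z. Randomness therefore
    enters only at z = 0: the passage from 0 to z holds for every single tempered distribution, with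
    constants that depend only on a bound for |x| and |xi|. Differentiating V_{h_k} u along a ray
    means differentiating under u, which is known only to be continuous for the Schwartz seminorms.
    Hence a class of Gaussian packets closed under derivatives in the path parameter and in t, whose
    Taylor remainders along the path are quadratic in every seminorm. The polynomial growth in k has
    the same source as the energy identity: the ladder relations trade each multiplication by t and
    each derivative for neighbouring indices with coefficients of size sqrt(k). At z = 0 the test
    functions z h_k + z' h_l give the mean cosines of pairwise sums and differences, which is all
    that a second-moment estimate uses. *)

Section real_derivatives.
Variable R : realType.
Implicit Types (f g : R -> R) (x a b : R).

Lemma is_derive_add f g x a b : is_derive x 1 f a -> is_derive x 1 g b ->
  is_derive x 1 (fun t => f t + g t) (a + b).
Proof. by move=> fa gb; exact: is_deriveD. Qed.

Lemma is_derive_opp f x a : is_derive x 1 f a ->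
  is_derive x 1 (fun t => - f t) (- a).
Proof. by move=> fa; exact: is_deriveN. Qed.

Lemma is_derive_mul f g x a b : is_derive x 1 f a -> is_derive x 1 g b ->
  is_derive x 1 (fun t => f t * g t) (a * g x + f x * b).
Proof.
move=> fa gb; apply: (@is_derive_eq _ _ _ (f * g)).
by rewrite /GRing.scale/= addrC mulrC.
Qed.

Lemma is_derive_pow f n x a : is_derive x 1 f a ->
  is_derive x 1 (fun t => f t ^+ n) (n%:R * f x ^+ n.-1 * a).
Proof.
move=> fa; rewrite (_ : (fun t => _) = f ^+ n); last first.
  by apply/funext => t; rewrite exprfctE.
exact: is_deriveX.
Qed.

Lemma is_derive_expR_comp f x a : is_derive x 1 f a ->
  is_derive x 1 (fun t => expR (f t)) (expR (f x) * a).
Proof.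
move=> fa; apply: (@is_derive_eq _ _ _ (expR \o f)).
by rewrite mulrC.
Qed.

Lemma is_derive_cos_comp f x a : is_derive x 1 f a ->
  is_derive x 1 (fun t => cos (f t)) (- sin (f x) * a).
Proof.
move=> fa; apply: (@is_derive_eq _ _ _ (cos \o f)).
by rewrite mulrC.
Qed.

Lemma is_derive_sin_comp f x a : is_derive x 1 f a ->
  is_derive x 1 (fun t => sin (f t)) (cos (f x) * a).
Proof.
move=> fa; apply: (@is_derive_eq _ _ _ (sin \o f)).
by rewrite mulrC.
Qed.

Lemma is_derive_comp_fun f g x a b : is_derive (g x) 1 f a ->
  is_derive x 1 g b -> is_derive x 1 (fun t => f (g t)) (a * b).
Proof. by move=> fa gb; apply: (@is_derive_eq _ _ _ (f \o g)); rewrite mulrC. Qed.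

Lemma is_derive_const (c : R) x : is_derive x 1 (fun=> c) 0.
Proof. exact: is_derive_cst. Qed.

Lemma is_derive_var x : is_derive x 1 (fun t : R => t) 1.
Proof. exact: is_derive_id. Qed.

Lemma is_derive_scale (c : R) x : is_derive x 1 ( *%R c) c.
Proof.
apply: (@is_derive_eq _ _ _ (fun t : R => c * t)).
by rewrite /GRing.scale/= mulr1.
Qed.

End real_derivatives.

(** Differentiation driven by the syntax of the function, with no instance search. [derive] leaves
    one goal: the computed derivative equals the stated one. *)
Ltac derive_rules :=
  solve [ lazymatch goal with
  | |- is_derive _ _ (fun t => t) _ => notypeclasses refine (is_derive_var _)
  | |- is_derive _ _ (fun t => _ + _) _ => notypeclasses refine (is_derive_add _ _); derive_rules
  | |- is_derive _ _ (fun t => - _) _ => notypeclasses refine (is_derive_opp _); derive_rules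
  | |- is_derive _ _ (fun t => _ * _) _ => notypeclasses refine (is_derive_mul _ _); derive_rules
  | |- is_derive _ _ (fun t => _ ^+ _) _ => notypeclasses refine (is_derive_pow _ _); derive_rules
  | |- is_derive _ _ (fun t => expR _) _ =>
      notypeclasses refine (is_derive_expR_comp _); derive_rules
  | |- is_derive _ _ (fun t => cos _) _ =>
      notypeclasses refine (is_derive_cos_comp _); derive_rules
  | |- is_derive _ _ (fun t => sin _) _ =>
      notypeclasses refine (is_derive_sin_comp _); derive_rules
  | |- is_derive _ _ (GRing.mul _) _ => notypeclasses refine (is_derive_scale _ _)
  | _ => first [ notypeclasses refine (is_derive_const _ _) | eassumption
               | match goal with H : forall _, _ |- _ => notypeclasses refine (H _) end ]
  end ].
Ltac derive :=
  notypeclasses refine (@is_derive_eq _ _ _ _ _ _ _ _ _ _);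
  [derive_rules|].

Section hermite_functions.
Variable R : realType.
Implicit Types (t : R) (n : nat).

(** For g(t) = exp(-2 pi t^2), the Leibniz rule applied to g' = -4 pi t g expresses each derivative
    of g through the two preceding ones. *)
Fixpoint gauss_derivative n t : R :=
  match n with
  | 0 => expR (- (2 * pi * t ^+ 2))
  | 1 => - 4 * pi * t * expR (- (2 * pi * t ^+ 2))
  | (m.+1 as n').+1 => - 4 * pi *
      (t * gauss_derivative n' t + n'%:R * gauss_derivative m t)
  end.

Lemma gauss_derivativeS n t : gauss_derivative n.+1 t = - 4 * pi *
  (t * gauss_derivative n t + n%:R * gauss_derivative n.-1 t).
Proof. by case: n => [|n]//; rewrite mul0r addr0 mulrA. Qed.

Lemma is_derive_gauss_derivative n t :
  is_derive t 1 (gauss_derivative n) (gauss_derivative n.+1 t).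
Proof.
suff: is_derive t 1 (gauss_derivative n) (gauss_derivative n.+1 t) /\
  is_derive t 1 (gauss_derivative n.+1) (gauss_derivative n.+2 t) by case.
elim: n => [|n [IH0 IH1]].
  split.
    rewrite (_ : gauss_derivative 0 = fun s => expR (- (2 * pi * s ^+ 2)))//.
    by derive => /=; ring.
  rewrite (_ : gauss_derivative 1 =
    fun s => - 4 * pi * s * expR (- (2 * pi * s ^+ 2)))//.
  by derive => /=; ring.
split => //.
rewrite (_ : gauss_derivative n.+2 = fun s => - 4 * pi *
   (s * gauss_derivative n.+1 s + n.+1%:R * gauss_derivative n s))//.
by derive; rewrite (gauss_derivativeS n.+2) -[n.+2.-1]/n.+1; ring.
Qed.

Lemma derive1n_gauss n :
  derive1n n (fun s : R => expR (- (2 * pi * s ^+ 2))) = gauss_derivative n.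
Proof.
elim: n => [|n IH]; first by [].
rewrite derive1nS IH; apply/funext => t; rewrite derive1E.
exact: (@derive_val _ _ _ _ _ _ _ (is_derive_gauss_derivative n t)).
Qed.

Let c n : R := 2 `^ (4^-1) / Num.sqrt (n`!%:R) * (- 1 / (2 * Num.sqrt pi)) ^+ n.

Lemma hermiteE n :
  hermite n = fun t => c n * expR (pi * t ^+ 2) * gauss_derivative n t.
Proof. by apply/funext => t; rewrite /hermite derive1n_gauss. Qed.

Lemma sqrtpi_gt0 : 0 < Num.sqrt (pi : R).
Proof. by rewrite sqrtr_gt0 pi_gt0. Qed.

Lemma sqr_sqrtpi : Num.sqrt (pi : R) ^+ 2 = pi.
Proof. exact: sqr_sqrtr (pi_ge0 R). Qed.

Lemma sqrtn_sqr n : Num.sqrt n%:R ^+ 2 = n%:R :> R.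
Proof. by rewrite sqr_sqrtr. Qed.

Lemma cS n : Num.sqrt n.+1%:R * c n.+1 * (2 * Num.sqrt pi) = - c n.
Proof.
have h := sqrtpi_gt0; have h1 : Num.sqrt n.+1%:R != 0 :> R by rewrite sqrtr_eq0 -ltNge.
have h2 : Num.sqrt n`!%:R != 0 :> R.
  by rewrite sqrtr_eq0 -ltNge ltr0n fact_gt0.
rewrite /c factS natrM sqrtrM// exprS; field.
by rewrite h2 h1 gt_eqF.
Qed.

Lemma hermite0 t : hermite 0 t = 2 `^ (4^-1) * expR (- (pi * t ^+ 2)).
Proof.
rewrite hermiteE /c fact0 sqrtr1 expr0 /= divr1 mulr1 -mulrA -expRD.
by congr (_ * expR _); ring.
Qed.

Lemma hermiteSS n t : Num.sqrt n.+2%:R * hermite n.+2 t =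
  2 * Num.sqrt pi * t * hermite n.+1 t - Num.sqrt n.+1%:R * hermite n t.
Proof.
have h := sqrtpi_gt0; have h1 : Num.sqrt n.+1%:R != 0 :> R by rewrite sqrtr_eq0 -ltNge.
have h2 : Num.sqrt n.+2%:R != 0 :> R by rewrite sqrtr_eq0 -ltNge.
have e0 : c n = - (Num.sqrt n.+1%:R * c n.+1 * (2 * Num.sqrt pi)).
  by rewrite cS opprK.
have e1 : Num.sqrt n.+2%:R * c n.+2 = - (c n.+1 / (2 * Num.sqrt pi)).
  rewrite -mulNr -cS mulfK//; apply/eqP => /eqP.
  by rewrite mulf_eq0 (gt_eqF h) orbF pnatr_eq0.
rewrite !hermiteE gauss_derivativeS e0 -[n.+1.-1]/n.
transitivity (Num.sqrt n.+2%:R * c n.+2 * (expR (pi * t ^+ 2) * (- 4 * pi *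
  (t * gauss_derivative n.+1 t + n.+1%:R * gauss_derivative n t)))); first ring.
rewrite e1.
have -> : - 4 * pi = - 4 * Num.sqrt pi ^+ 2 :> R by rewrite sqr_sqrtpi.
rewrite -[n.+1%:R in LHS]sqrtn_sqr.
by field; rewrite gt_eqF.
Qed.

Lemma hermite1 t : hermite 1 t = 2 * Num.sqrt pi * t * hermite 0 t.
Proof.
have h := sqrtpi_gt0.
have e0 : c 0 = - (c 1 * (2 * Num.sqrt pi)).
  by rewrite -[LHS]opprK -cS sqrtr1 mul1r.
rewrite !hermiteE e0 gauss_derivativeS.
have -> : - 4 * pi = - 4 * Num.sqrt pi ^+ 2 :> R by rewrite sqr_sqrtpi.
by ring.
Qed.

(* At [n = 0] the vanishing factor makes the junk index [n.-1] harmless. *)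
Lemma hermite_rec n t : Num.sqrt n.+1%:R * hermite n.+1 t =
  2 * Num.sqrt pi * t * hermite n t - Num.sqrt n%:R * hermite n.-1 t.
Proof.
by case: n => [|n]; [rewrite sqrtr1 sqrtr0 hermite1; ring|exact: hermiteSS].
Qed.

(** The product rule gives 2 pi t h_n - 2 sqrt(pi) sqrt(n+1) h_{n+1}; the three-term relation then
    replaces t h_n by the two neighbours. *)
Lemma is_derive_hermite n t : is_derive t 1 (hermite n)
  (Num.sqrt pi * (Num.sqrt n%:R * hermite n.-1 t
                  - Num.sqrt n.+1%:R * hermite n.+1 t)).
Proof.
have H := is_derive_gauss_derivative n t.
rewrite {1}hermiteE; derive.
have e : Num.sqrt n%:R * hermite n.-1 t =
   2 * Num.sqrt pi * t * hermite n t - Num.sqrt n.+1%:R * hermite n.+1 t.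
  by rewrite hermite_rec; ring.
rewrite e {e} [X in _ = X](_ : _ = 2 * Num.sqrt pi ^+ 2 * t * hermite n t -
   2 * Num.sqrt pi * (Num.sqrt n.+1%:R * hermite n.+1 t)); last by ring.
rewrite sqr_sqrtpi !hermiteE.
rewrite [X in _ = X](_ : _ = 2 * pi * t * (c n * expR (pi * t ^+ 2) * gauss_derivative n t)
  - Num.sqrt n.+1%:R * c n.+1 * (2 * Num.sqrt pi)
    * (expR (pi * t ^+ 2) * gauss_derivative n.+1 t)); last by ring.
by rewrite cS; ring.
Qed.

(* Working with an abstract [h] keeps conversion from unfolding [hermite]. *)
Definition hermite_system (h : nat -> R -> R) : Prop :=
  [/\ forall t, h 0 t = 2 `^ 4^-1 * expR (- (pi * t ^+ 2)),
      forall n t, Num.sqrt n.+1%:R * h n.+1 t =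
        2 * Num.sqrt pi * t * h n t - Num.sqrt n%:R * h n.-1 t &
      forall n t, is_derive t 1 (h n) (Num.sqrt pi *
        (Num.sqrt n%:R * h n.-1 t - Num.sqrt n.+1%:R * h n.+1 t))].

Lemma hermite_systemP : hermite_system hermite.
Proof.
by split; [exact: hermite0|exact: hermite_rec|exact: is_derive_hermite].
Qed.

End hermite_functions.

(** * Integrals bundled with their values *)

Section has_integral.
Context d (T : measurableType d) (R : realType).
Variable mu : {measure set T -> \bar R}.
Implicit Types (f g : T -> R) (v w : R).

(** Integrability travels with the value, so linear combinations are evaluated without side
    conditions. It serves both Lebesgue measure and the probability [P]. *)
Definition has_integral f v :=
  mu.-integrable setT (EFin \o f) /\ (\int[mu]_t (f t)%:E = v%:E)%E.

Lemma has_integralD f g v w : has_integral f v -> has_integral g w ->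
  has_integral (fun t => f t + g t) (v + w).
Proof.
move=> [If fv] [Ig gw]; split.
  rewrite (_ : _ \o _ = (EFin \o f) \+ (EFin \o g))%E; first exact: integrableD.
  by apply/funext.
by under eq_integral do rewrite EFinD; rewrite integralD_EFin// fv gw.
Qed.

Lemma has_integralZ f (a : R) v : has_integral f v ->
  has_integral (fun t => a * f t) (a * v).
Proof.
move=> [If fv]; split; first exact: (integrableZl measurableT _ If).
by under eq_integral do rewrite EFinM; rewrite integralZl// fv.
Qed.

Lemma has_integral0 : has_integral (fun=> 0) 0.
Proof. by split; [exact: integrable0|exact: integral0]. Qed.

Lemma has_integral_sum n (f : nat -> T -> R) (v : nat -> R) :
  (forall k, (k < n)%N -> has_integral (f k) (v k)) ->
  has_integral (fun t => \sum_(k < n) f k t) (\sum_(k < n) v k).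
Proof.
elim: n => [|n IH] H.
  rewrite big_ord0 (_ : (fun t => _) = fun=> 0); first exact: has_integral0.
  by apply/funext => t; rewrite big_ord0.
rewrite big_ord_recr (_ : (fun t => _) = fun t => \sum_(k < n) f k t + f n t).
  apply: has_integralD; last exact: H.
  by apply: IH => k kn; apply: H; exact: ltnW.
by apply/funext => t; rewrite big_ord_recr.
Qed.

Lemma has_integral_le f g v w : has_integral f v -> has_integral g w ->
  (forall t, f t <= g t) -> v <= w.
Proof.
move=> [If fv] [Ig gw] fg; rewrite -lee_fin -fv -gw.
by apply: le_integral => // t _; rewrite lee_fin.
Qed.

End has_integral.

(** * Decay, orthonormality and sup bounds of the Hermite functions *)

Section gaussian_decay.
Variable R : realType.
Implicit Types (f F : R -> R) (t : R).
Variable h : nat -> R -> R.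
Hypothesis hS : hermite_system h.
Let h0 : forall t, h 0 t = 2 `^ 4^-1 * expR (- (pi * t ^+ 2)).
Proof. by case: hS. Qed.
Let hrec : forall n t, Num.sqrt n.+1%:R * h n.+1 t =
  2 * Num.sqrt pi * t * h n t - Num.sqrt n%:R * h n.-1 t.
Proof. by case: hS. Qed.
Let dh : forall n t, is_derive t 1 (h n) (Num.sqrt pi *
  (Num.sqrt n%:R * h n.-1 t - Num.sqrt n.+1%:R * h n.+1 t)).
Proof. by case: hS. Qed.

(** For |t| > 1, |t|^j is at most t^(2j), and (a t^2)^j <= j! exp(a t^2) by the exponential series;
    for |t| <= 1 the bound 1 is enough. *)
Lemma pow_gauss_bounded (a : R) j : 0 < a ->
  exists C : R, 0 <= C /\ forall t, `|t| ^+ j * expR (- (a * t ^+ 2)) <= C.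
Proof.
move=> a0; exists (1 + j`!%:R / a ^+ j); split.
  by rewrite addr_ge0// divr_ge0// exprn_ge0// ltW.
move=> t; have at0 : 0 <= a * t ^+ 2 by rewrite mulr_ge0 ?sqr_ge0// ltW.
have e1 : expR (- (a * t ^+ 2)) <= 1 by rewrite expR_le1 oppr_le0.
have h1 : (a * t ^+ 2) ^+ j * expR (- (a * t ^+ 2)) <= j`!%:R.
  rewrite expRN ler_pdivrMr ?expR_gt0// -ler_pdivrMl ?ltr0n ?fact_gt0// mulrC.
  case: j => [|j].
    by rewrite expr0 fact0 divr1 -expR0 ler_expR.
  by apply: le_trans (expR_ge1Dxn j at0); rewrite lerDr.
have [t1|/ltW t1] := leP `|t| 1.
  apply: (@le_trans _ _ 1); last by rewrite lerDl divr_ge0// exprn_ge0// ltW.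
  by rewrite -[leRHS]mulr1 ler_pM// ?expR_ge0 ?exprn_ge0// exprn_ile1.
rewrite -[leLHS]add0r lerD// ler_pdivlMr ?exprn_gt0//.
apply: le_trans h1; rewrite exprMn [leLHS]mulrC -[leRHS]mulrA ler_wpM2l
  ?exprn_ge0 ?(ltW a0)// ler_wpM2r ?expR_ge0//.
by rewrite -(real_normK (num_real t)) -exprM mulnC exprM expr2 ler_peMl// ?exprn_ge0// exprn_ege1.
Qed.

(** Half of the exponent of h_0 is given up to absorb powers of t. The three-term relation carries
    the bound to higher indices, each step using one more power of |t|. *)
Lemma hermite_decay n j : exists C : R, 0 <= C /\ forall t,
  `|t| ^+ j * `|h n t| <= C * expR (- (pi / 2 * t ^+ 2)).
Proof.
have pi2 : 0 < pi / 2 :> R by rewrite divr_gt0// pi_gt0.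
suff: forall n, (forall j, exists C : R, 0 <= C /\ forall t,
  `|t| ^+ j * `|h n t| <= C * expR (- (pi / 2 * t ^+ 2))) /\
  (forall j, exists C : R, 0 <= C /\ forall t,
  `|t| ^+ j * `|h n.+1 t| <= C * expR (- (pi / 2 * t ^+ 2))).
  by move=> /(_ n)[/(_ j)].
have H0 i : exists C : R, 0 <= C /\ forall t,
    `|t| ^+ i * `|h 0 t| <= C * expR (- (pi / 2 * t ^+ 2)).
  have [C [C0 HC]] := pow_gauss_bounded i pi2.
  exists (2 `^ 4^-1 * C); split; first by rewrite mulr_ge0// powR_ge0.
  move=> t; rewrite h0 [`|_ * _|]ger0_norm ?mulr_ge0 ?powR_ge0 ?expR_ge0//.
  rewrite (_ : - (pi * t ^+ 2) = - (pi / 2 * t ^+ 2) + - (pi / 2 * t ^+ 2));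
    last by field.
  rewrite expRD; set e := expR _.
  rewrite [leLHS](_ : _ = 2 `^ 4^-1 * (`|t| ^+ i * e) * e); last by ring.
  by rewrite ler_wpM2r ?expR_ge0// ler_wpM2l ?powR_ge0.
have HS m : (forall i, exists C : R, 0 <= C /\ forall t,
    `|t| ^+ i * `|h m t| <= C * expR (- (pi / 2 * t ^+ 2))) ->
    (forall i, exists C : R, 0 <= C /\ forall t,
    `|t| ^+ i * `|h m.-1 t| <= C * expR (- (pi / 2 * t ^+ 2))) ->
    forall i, exists C : R, 0 <= C /\ forall t,
    `|t| ^+ i * `|h m.+1 t| <= C * expR (- (pi / 2 * t ^+ 2)).
  move=> H1 H2 i; have [C1 [C10 HC1]] := H1 i.+1.
  have [C2 [C20 HC2]] := H2 i.
  have s0 : 0 < Num.sqrt m.+1%:R :> R by rewrite sqrtr_gt0.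
  have p0 := ltW (sqrtpi_gt0 R).
  exists ((2 * Num.sqrt pi * C1 + Num.sqrt m%:R * C2) / Num.sqrt m.+1%:R).
  split; first by rewrite divr_ge0 ?addr_ge0 ?mulr_ge0 ?sqrtr_ge0.
  move=> t; set e := expR _.
  have k : Num.sqrt m.+1%:R * `|h m.+1 t| <=
      2 * Num.sqrt pi * (`|t| * `|h m t|) + Num.sqrt m%:R * `|h m.-1 t|.
    rewrite -{1}(ger0_norm (ltW s0)) -normrM hrec (le_trans (ler_normB _ _))//.
    by rewrite !normrM (ger0_norm p0) (ger0_norm (sqrtr_ge0 m%:R)) normr_nat !mulrA.
  rewrite mulrAC ler_pdivlMr//.
  rewrite [leLHS](_ : _ = `|t| ^+ i * (Num.sqrt m.+1%:R * `|h m.+1 t|));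
    last by ring.
  apply: le_trans (ler_wpM2l (exprn_ge0 i (normr_ge0 t)) k) _.
  rewrite [leLHS](_ : _ = 2 * Num.sqrt pi * (`|t| ^+ i.+1 * `|h m t|) +
    Num.sqrt m%:R * (`|t| ^+ i * `|h m.-1 t|)); last by rewrite exprS; ring.
  rewrite [leRHS]mulrDl; apply: lerD;
    by rewrite -[leRHS]mulrA ler_wpM2l ?mulr_ge0 ?sqrtr_ge0.
elim=> [|m [IH0 IH1]]; first by split=> //; exact: HS.
by split => //; exact: HS.
Qed.

Local Notation mu := (@lebesgue_measure R).

Lemma integrable_gauss : mu.-integrable setT (EFin \o (fun t => expR (- (pi * t ^+ 2)))).
Proof.
(* The normal density of variance 1 / (2 pi) is exactly exp(-pi t^2). *)
pose s : R := (Num.sqrt (pi *+ 2))^-1.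
have p2 : 0 < pi *+ 2 :> R by rewrite mulrn_wgt0// pi_gt0.
have s0 : s != 0 by rewrite invr_eq0 sqrtr_eq0 -ltNge.
rewrite (_ : (fun t => _) = normal_pdf 0 s); first exact: integrable_normal_pdf.
have s2 : s ^+ 2 = (pi *+ 2)^-1 by rewrite exprVn sqr_sqrtr ?ltW.
apply/funext => t; rewrite normal_pdfE// /normal_peak /normal_fun s2 subr0.
rewrite -mulrnAr mulVf ?gt_eqF// sqrtr1 invr1 mul1r; congr expR.
have : pi != 0 :> R by rewrite gt_eqF ?pi_gt0.
by move: pi => q q0; rewrite -(mulr_natr q) -(mulr_natr _^-1); field.
Qed.

Lemma continuous_is_derive f f' : (forall t, is_derive t 1 f (f' t)) ->
  continuous f.
Proof.
by move=> df t; apply: differentiable_continuous; apply/derivable1_diffP;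
  exact: ex_derive.
Qed.

Lemma integrable_gauss_bound f C : continuous f ->
  (forall t, `|f t| <= C * expR (- (pi * t ^+ 2))) ->
  mu.-integrable setT (EFin \o f).
Proof.
move=> cf fC; apply: (le_integrable _ _ _ (integrableZl measurableT C integrable_gauss)) => //.
  by apply/measurable_EFinP; exact: continuous_measurable_fun.
by move=> t _ /=; rewrite lee_fin (le_trans (fC t))// ler_norm.
Qed.

Lemma integral_segment_derive F f (a b : R) : a < b ->
  (forall t, is_derive t 1 F (f t)) -> continuous f ->
  (\int[mu]_(t in `[a, b]) (f t)%:E = (F b - F a)%:E)%E.
Proof.
move=> ab dF cf; rewrite (@continuous_FTC2 _ _ F)//.
- exact: continuous_subspaceT.
- have cF := continuous_is_derive dF.
  split; first by move=> x _; exact: ex_derive.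
    exact/cvg_at_right_filter/cF.
  exact/cvg_at_left_filter/cF.
- by move=> x _; rewrite derive1E; exact: derive_val.
Qed.

Lemma gauss_bound_tail F C n t :
  (forall t, `|F t| <= C * expR (- (pi * t ^+ 2))) ->
  n%:R <= `|t| -> `|F t| <= C * expR (- n%:R).
Proof.
move=> FC nt; have C0 : 0 <= C.
  by have := FC 0; rewrite expr0n/= mulr0 oppr0 expR0 mulr1; exact: le_trans.
apply: (le_trans (FC t)); apply: ler_wpM2l => //; rewrite ler_expR lerN2.
apply: (@le_trans _ _ (n%:R ^+ 2)).
  by rewrite -natrX ler_nat; case: n {nt} => // n; rewrite expnS leq_pmulr.
rewrite -[leLHS]mul1r ler_pM// ?exprn_ge0//; first by have := pi_ge2 R; lra.
by rewrite -(real_normK (num_real t)) lerXn2r ?nnegrE.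
Qed.

(** On a symmetric segment the integral is a difference of boundary values of [F], which the
    Gaussian bound sends to 0; dominated convergence passes to the whole line. *)
Lemma integral_derive_eq0 F f C1 C2 :
  (forall t, is_derive t 1 F (f t)) -> continuous f ->
  (forall t, `|F t| <= C1 * expR (- (pi * t ^+ 2))) ->
  (forall t, `|f t| <= C2 * expR (- (pi * t ^+ 2))) ->
  (\int[mu]_t (f t)%:E = 0)%E.
Proof.
move=> dF cf F1 f2.
have If := integrable_gauss_bound cf f2.
have mf : measurable_fun setT (EFin \o f) by exact: measurable_int If.
(* [n.+1] keeps the segment nondegenerate, as [integral_segment_derive] requires. *)
pose J n : set R := `[- n.+1%:R, n.+1%:R]%classic.
have mJ n : measurable (J n : set R) by exact: measurable_itv.
have [|||||_ _] := @dominated_convergence _ _ _ mu setT measurableT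
   (fun n => (EFin \o f) \_ (J n)) (EFin \o f) (abse \o (EFin \o f)).
- move=> n; apply: (iffLR (measurable_restrictT _ (mJ n))).
  exact: measurable_funS mf.
- exact: mf.
- apply/aeW => x _; apply: cvg_near_cst; exists `|Num.ceil `|x| |%N => // n /= xn.
  rewrite patchE mem_set//= /J /= in_itv/= -ler_norml.
  rewrite (le_trans (ceil_ge _))// (le_trans (ler_norm _))//.
  by rewrite -intr_norm -natr_absz ler_nat leqW.
- exact: integrable_abse.
- apply/aeW => x n _; rewrite patchE; case: ifP => _ //=.
  by rewrite normr0 lee_fin.
move=> /cvg_lim <-//; apply/cvg_lim => //.
have E n : (\int[mu]_x ((EFin \o f) \_ (J n)) x = (F n.+1%:R - F (- n.+1%:R))%:E)%E.
  rewrite -integral_mkcond; apply: integral_segment_derive => //.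
  by rewrite gtrN// ltr0n.
rewrite (_ : (fun n => _) = EFin \o (fun n => F n.+1%:R - F (- n.+1%:R)));
  last exact/funext.
apply/cvg_EFin; first exact: nearW.
apply/norm_cvg0P => /=.
apply: (@squeeze_cvgr _ _ _ _ (fun=> 0) (fun n => 2 * C1 * expR (- n.+1%:R))).
- apply: nearW => n; rewrite normr_ge0/= (le_trans (ler_normB _ _))//.
  rewrite -mulrA mulr_natl mulr2n; apply: lerD; apply: (gauss_bound_tail F1).
    by rewrite normr_nat.
  by rewrite normrN normr_nat.
- exact: cvg_cst.
- rewrite -(mulr0 (2 * C1)); apply: cvgMr.
  by have := @cvgn_expR R; rewrite -(cvg_shiftS _).
Qed.

Lemma continuous_hermite n : continuous (h n : R -> R).
Proof. exact: continuous_is_derive (dh n). Qed.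

Lemma hermite_mul_decay m n : exists C : R, forall t,
  `|h m t * h n t| <= C * expR (- (pi * t ^+ 2)).
Proof.
have [C [C0 HC]] := hermite_decay m 0; have [D [D0 HD]] := hermite_decay n 0.
exists (C * D) => t; move: (HC t) (HD t); rewrite !expr0 !mul1r => h1 h2; rewrite normrM.
rewrite (_ : - (pi * t ^+ 2) = - (pi / 2 * t ^+ 2) + - (pi / 2 * t ^+ 2));
  last by field.
by rewrite expRD mulrACA ler_pM.
Qed.

Lemma integrable_hermiteM m n :
  mu.-integrable setT (EFin \o (fun t => h m t * h n t)).
Proof.
have [C HC] := hermite_mul_decay m n; apply: integrable_gauss_bound HC => t.
by apply: continuousM; exact: continuous_hermite.
Qed.

Definition hermite_inner m n : R :=
  (\int[mu]_t (h m t * h n t))%R.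

Lemma integral_hermiteM m n :
  (\int[mu]_t (h m t * h n t)%:E = (hermite_inner m n)%:E)%E.
Proof.
rewrite /hermite_inner /Rintegral fineK//.
exact: integrable_fin_num (integrable_hermiteM m n).
Qed.

Lemma hermite_innerC m n : hermite_inner m n = hermite_inner n m.
Proof. by apply: eq_Rintegral => t _; rewrite mulrC. Qed.

Lemma hermite_inner00 : hermite_inner 0 0 = 1.
Proof.
apply/EFin_inj; rewrite -integral_hermiteM.
(* h_0^2 is the normal density of variance 1 / (4 pi). *)
pose s : R := (2 * Num.sqrt pi)^-1.
have p0 := sqrtpi_gt0 R.
have s0 : s != 0 by rewrite invr_eq0 mulf_neq0 ?gt_eqF.
have pi0 : pi != 0 :> R by rewrite gt_eqF ?pi_gt0.
rewrite -(@integral_normal_pdf R 0 s); apply: eq_integral => t _; congr EFin.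
have s2 : s ^+ 2 = (4 * pi)^-1.
  by rewrite exprVn exprMn (sqr_sqrtpi R); congr (_ * _)^-1; rewrite -natrX.
rewrite normal_pdfE// /normal_peak /normal_fun s2 subr0 !h0.
rewrite mulrACA -powRD ?pnatr_eq0 ?implybT// -expRD; congr (_ * expR _).
  rewrite -(mulr_natr (_ * pi)) (_ : (4 * pi)^-1 * pi * 2%:R = 2^-1); last first.
    by move: pi pi0 => q q0; field.
  rewrite sqrtrV// invrK (_ : 4^-1 + 4^-1 = 2^-1); last by field.
  by rewrite powR12_sqrt.
by move: pi pi0 => q q0; rewrite -(mulr_natr (_^-1)); field.
Qed.

(* Integrate the derivative of [h m * h n]. *)
Lemma hermite_inner_step m n :
  Num.sqrt m%:R * hermite_inner m.-1 n = Num.sqrt n.+1%:R * hermite_inner m n.+1.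
Proof.
have I1 := integrable_hermiteM m.-1 n; have I2 := integrable_hermiteM m n.+1.
have [C1 HC1] := hermite_mul_decay m n.
have [C2 HC2] := hermite_mul_decay m.-1 n.
have [C3 HC3] := hermite_mul_decay m n.+1.
have p0 := ltW (sqrtpi_gt0 R).
pose a t : R := h m.-1 t * h n t.
pose b t : R := h m t * h n.+1 t.
pose f t : R := Num.sqrt m%:R * a t - Num.sqrt n.+1%:R * b t.
have df t : is_derive t 1 (fun t => (2 * Num.sqrt pi)^-1 * (h m t * h n t)) (f t).
  have Hm := dh m t; have Hn := dh n t; derive.
  (* Eliminating [h m.+1] and [h n.-1] by the three-term relation makes the terms containing t
     cancel. *)
  have em : Num.sqrt m.+1%:R * h m.+1 t =
    2 * Num.sqrt pi * t * h m t - Num.sqrt m%:R * h m.-1 t :> R.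
    exact: hrec.
  have en : Num.sqrt n%:R * h n.-1 t =
    2 * Num.sqrt pi * t * h n t - Num.sqrt n.+1%:R * h n.+1 t :> R.
    by rewrite hrec; ring.
  rewrite em en /f /a /b; field.
  by rewrite gt_eqF ?sqrtpi_gt0.
have cf : continuous f.
  move=> t; apply: cvgB; (apply: cvgM; [exact: cvg_cst|]);
    apply: cvgM; exact: continuous_hermite.
have f0 : (\int[mu]_t (f t)%:E = 0)%E.
  apply: (integral_derive_eq0 df cf
    (C1 := (2 * Num.sqrt pi)^-1 * C1) (C2 := Num.sqrt m%:R * C2 + Num.sqrt n.+1%:R * C3)).
    move=> t; rewrite normrM -[leRHS]mulrA ger0_norm ?invr_ge0 ?mulr_ge0//.
    by apply: ler_wpM2l; rewrite ?invr_ge0 ?mulr_ge0.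
  have sq0 k : `|Num.sqrt k%:R| = Num.sqrt k%:R :> R by rewrite ger0_norm ?sqrtr_ge0.
  move=> t; apply: le_trans (ler_normB _ _) _; rewrite [leRHS]mulrDl; apply: lerD;
    rewrite normrM sq0 -[leRHS]mulrA; apply: ler_wpM2l; rewrite ?sqrtr_ge0//.
  - exact: HC2.
  - exact: HC3.
apply/eqP; rewrite -subr_eq0; apply/eqP/EFin_inj; rewrite -[RHS]f0 EFinB !EFinM.
rewrite -!integral_hermiteM.
rewrite -!integralZl//.
under [RHS]eq_integral do rewrite /f EFinB.
rewrite integralB_EFin//.
- exact: (integrableZl measurableT _ I1).
- exact: (integrableZl measurableT _ I2).
Qed.

(** At m = 0 the factor sqrt 0 in [hermite_inner_step] gives orthogonality to h_0. Further uses
    lower both indices together. *)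
Lemma hermite_innerE m n : hermite_inner m n = (m == n)%:R.
Proof.
have H0 k : hermite_inner 0 k.+1 = 0.
  have /esym/eqP := hermite_inner_step 0 k.
  by rewrite sqrtr0 mul0r mulf_eq0 gt_eqF ?sqrtr_gt0 ?ltr0n//= => /eqP.
elim: n m => [|n IH] [|m]; rewrite ?hermite_inner00 ?H0//.
  by rewrite hermite_innerC H0.
have := hermite_inner_step m.+1 n; rewrite -[m.+1.-1]/m IH eqSS.
have [->|mn] := eqVneq m n; first last.
  move=> /esym/eqP; rewrite mulr0 mulf_eq0 gt_eqF ?sqrtr_gt0 ?ltr0n//=.
  by move=> /eqP.
by move=> /mulfI => -> //; rewrite sqrtr_eq0 -ltNge.
Qed.

Lemma has_integral_hermiteM m n :
  has_integral mu (fun t => h m t * h n t) (m == n)%:R.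
Proof.
split; first exact: integrable_hermiteM.
by rewrite integral_hermiteM hermite_innerE.
Qed.

(* [h n t ^+ 2] is the integral of [2 * h n * h n^`()] up to [t], hence at most
   that of [h n ^+ 2 + h n^`() ^+ 2]. *)
Lemma hermite_sup n t : h n t ^+ 2 <= 1 + pi * (2 * n%:R + 1).
Proof.
pose h' t := Num.sqrt pi * (Num.sqrt n%:R * h n.-1 t - Num.sqrt n.+1%:R * h n.+1 t).
pose q t := h n t ^+ 2 + h' t ^+ 2.
(* Orthonormality gives 1 for the square of h_n and pi (n + (n+1)) for that of its derivative. The
   cross term vanishes, also for n = 0, where [n.-1] is 0 and [n.+1] is 1. *)
have Iq : has_integral mu q (1 + pi * (2 * n%:R + 1)).
  have -> : q = fun t => h n t * h n t + pi * (n%:R * (h n.-1 t * h n.-1 t) +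
    (n.+1%:R * (h n.+1 t * h n.+1 t) +
      - 2 * (Num.sqrt n%:R * Num.sqrt n.+1%:R) * (h n.-1 t * h n.+1 t))).
    apply/funext => x; rewrite /q /h' exprMn (sqr_sqrtpi R).
    have := sqrtn_sqr R n; have := sqrtn_sqr R n.+1.
    by move: (Num.sqrt n.+1%:R) (Num.sqrt n%:R) => a b <- <-; ring.
  have -> : 1 + pi * (2 * n%:R + 1) = (n == n)%:R + pi * (n%:R * (n.-1 == n.-1)%:R +
    (n.+1%:R * (n.+1 == n.+1)%:R +
      - 2 * (Num.sqrt n%:R * Num.sqrt n.+1%:R) * (n.-1 == n.+1)%:R)) :> R.
    have -> : (n.-1 == n.+1) = false by case: n {h' q} => // n; rewrite ltn_eqF.
    by rewrite !eqxx /= -natr1; ring.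
  apply: has_integralD; first exact: has_integral_hermiteM.
  apply: has_integralZ; apply: has_integralD.
    by apply: has_integralZ; exact: has_integral_hermiteM.
  apply: has_integralD.
    by apply: has_integralZ; exact: has_integral_hermiteM.
  by apply: has_integralZ; exact: has_integral_hermiteM.
have dh2 (x : R) : is_derive x 1 (fun t : R => h n t ^+ 2) (2 * h n x * h' x).
  by have H := dh n x; derive; rewrite /h'; ring.
have cf : continuous (fun x : R => 2 * h n x * h' x : R).
  have ch := continuous_hermite; move=> x; apply: cvgM; first apply: cvgM.
  - exact: cvg_cst.
  - exact: ch.
  - apply: cvgM; first exact: cvg_cst.
    by apply: cvgB; apply: cvgM; (try exact: cvg_cst); exact: ch.
have [C HC] := hermite_mul_decay n n.
have HC' x : `|h n x ^+ 2| <= C * expR (- (pi * x ^+ 2)) by rewrite expr2.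
(* Integration starts at -k, where [h n] is negligible; k then tends to infinity. *)
have step k : - k%:R < t -> h n t ^+ 2 <= (1 + pi * (2 * n%:R + 1)) + C * expR (- k%:R).
  move=> kt; rewrite -lerBlDr.
  apply: (@le_trans _ _ (h n t ^+ 2 - h n (- k%:R) ^+ 2)).
    rewrite lerD2l lerN2 (le_trans (ler_norm _))//.
    by apply: (gauss_bound_tail HC'); rewrite normrN normr_nat.
  rewrite -lee_fin -(integral_segment_derive kt dh2 cf) -Iq.2.
  apply: (@le_trans _ _ (\int[mu]_(x in `[(- k%:R)%R, t]) (q x)%:E)%E).
    apply: le_integral => //.
    - by apply: continuous_compact_integrable;
        [exact: segment_compact|exact: continuous_subspaceT].
    - exact: integrableS Iq.1.
    - move=> x _; rewrite lee_fin /q.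
      by have := sqr_ge0 (h n x - h' x); nra.
  apply: ge0_subset_integral => //.
  - by apply: measurable_int Iq.1.
  - by move=> x _; rewrite lee_fin addr_ge0 ?sqr_ge0.
have -> : 1 + pi * (2 * n%:R + 1) =
    limn (fun k : nat => 1 + pi * (2 * n%:R + 1) + C * expR (- k%:R)) :> R.
  apply/esym/cvg_lim => //; rewrite -[X in _ --> X]addr0; apply: cvgD; first exact: cvg_cst.
  by rewrite -(mulr0 C); apply: cvgMr; exact: cvgn_expR.
apply: limr_ge.
  apply: is_cvgD; first exact: is_cvg_cst.
  by apply: is_cvgMr; apply/cvg_ex; exists 0; exact: cvgn_expR.
exists `|Num.ceil `|t| |.+1 => // k /= tk; apply: step.
rewrite ltrNl (le_lt_trans (ler_norm _))// normrN (le_lt_trans (ceil_ge _))//.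
by rewrite (le_lt_trans (ler_norm _))// -intr_norm -natr_absz ltr_nat.
Qed.

End gaussian_decay.

(** * Complex-valued Schwartz functions and tempered distributions *)

Section complex_calculus.
Variable R : realType.
Implicit Types (f g : R -> R[i]) (t : R) (a b z : R[i]).

Local Notation normc := Normc.normc.
Local Notation Re := complex.Re.
Local Notation Im := complex.Im.

Lemma ReD a b : Re (a + b) = Re a + Re b. Proof. by case: a b => ? ? []. Qed.
Lemma ImD a b : Im (a + b) = Im a + Im b. Proof. by case: a b => ? ? []. Qed.
Lemma ReN a : Re (- a) = - Re a. Proof. by case: a. Qed.
Lemma ImN a : Im (- a) = - Im a. Proof. by case: a. Qed.
Lemma ReM a b : Re (a * b) = Re a * Re b - Im a * Im b.
Proof. by case: a b => ? ? []. Qed.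
Lemma ImM a b : Im (a * b) = Re a * Im b + Im a * Re b.
Proof. by case: a b => ? ? []. Qed.

Lemma eqC a b : Re a = Re b -> Im a = Im b -> a = b.
Proof. by case: a b => ? ? [] ? ? /= -> ->. Qed.

Lemma normcE2 a : normc a ^+ 2 = Re a ^+ 2 + Im a ^+ 2.
Proof. by case: a => x y /=; rewrite sqr_sqrtr ?addr_ge0 ?sqr_ge0. Qed.

Lemma normc_ge0 a : 0 <= normc a.
Proof. by case: a => x y; exact: sqrtr_ge0. Qed.

Lemma normc_Re a : `|Re a| <= normc a.
Proof.
rewrite -(ler_pXn2r (n := 2)) ?nnegrE ?normc_ge0// real_normK ?num_real//.
by rewrite normcE2 lerDl sqr_ge0.
Qed.

Lemma normc_Im a : `|Im a| <= normc a.
Proof.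
rewrite -(ler_pXn2r (n := 2)) ?nnegrE ?normc_ge0// real_normK ?num_real//.
by rewrite normcE2 lerDr sqr_ge0.
Qed.

Lemma normc_real (x : R) : normc x%:C = `|x|.
Proof. by rewrite /= expr0n/= addr0 sqrtr_sqr. Qed.

Lemma normc_le a : normc a <= `|Re a| + `|Im a|.
Proof.
rewrite -(ler_pXn2r (n := 2)) ?nnegrE ?normc_ge0 ?addr_ge0// normcE2.
rewrite sqrrD !real_normK ?num_real// -addrA lerD2l lerDr.
by rewrite mulrn_wge0// mulr_ge0.
Qed.

Lemma normc_expi (x : R) : normc (expi x) = 1.
Proof. by rewrite /expi /= cos2Dsin2 sqrtr1. Qed.

Definition cder f t z : Prop :=
  is_derive t 1 (fun s : R => Re (f s)) (Re z) /\
  is_derive t 1 (fun s : R => Im (f s)) (Im z).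

Lemma cderD f g t a b : cder f t a -> cder g t b ->
  cder (fun s => f s + g s) t (a + b).
Proof.
move=> [f1 f2] [g1 g2]; split.
  rewrite (_ : (fun s : R => _) = fun s : R => Re (f s) + Re (g s)).
    by rewrite ReD; exact: is_derive_add.
  by apply/funext => s; rewrite ReD.
rewrite (_ : (fun s : R => _) = fun s : R => Im (f s) + Im (g s)).
  by rewrite ImD; exact: is_derive_add.
by apply/funext => s; rewrite ImD.
Qed.

Lemma cderM f g t a b : cder f t a -> cder g t b ->
  cder (fun s => f s * g s) t (a * g t + f t * b).
Proof.
move=> [f1 f2] [g1 g2]; split.
  rewrite (_ : (fun s : R => _) = fun s : R => Re (f s) * Re (g s) - Im (f s) * Im (g s)).
    by derive; rewrite ReD !ReM; ring.
  by apply/funext => s; rewrite ReM.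
rewrite (_ : (fun s : R => _) = fun s : R => Re (f s) * Im (g s) + Im (f s) * Re (g s)).
  by derive; rewrite ImD !ImM; ring.
by apply/funext => s; rewrite ImM.
Qed.

Lemma cder_const a t : cder (fun=> a) t 0.
Proof. by split; exact: is_derive_const. Qed.

Lemma cder_real (f : R -> R) t (x : R) : is_derive t 1 f x ->
  cder (fun s => (f s)%:C) t x%:C.
Proof. by move=> fx; split => //; exact: is_derive_const. Qed.

Lemma cder_id t : cder (fun s : R => s%:C) t 1.
Proof. by apply: cder_real; exact: is_derive_var. Qed.

Lemma cder_expi (c : R) t : cder (fun s => expi (c * s)) t (('i * c%:C) * expi (c * t)).
Proof.
split; rewrite /expi /=; derive => /=; rewrite ?mulr0 ?mul0r ?mul1r ?subr0 ?add0r; ring.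
Qed.

Lemma cder_eq f t a b : cder f t a -> a = b -> cder f t b.
Proof. by move=> + <-. Qed.

Lemma cder_unique f t a b : cder f t a -> cder f t b -> a = b.
Proof.
move=> [a1 a2] [b1 b2]; apply: eqC.
  by rewrite -(@derive_val _ _ _ _ _ _ _ a1) -(@derive_val _ _ _ _ _ _ _ b1).
by rewrite -(@derive_val _ _ _ _ _ _ _ a2) -(@derive_val _ _ _ _ _ _ _ b2).
Qed.

Lemma derive1nSr (f : R -> R) n : derive1n n.+1 f = derive1n n (derive1 f).
Proof. exact: iterSr. Qed.

Lemma cderive1nSr f f' n : (forall t, cder f t (f' t)) ->
  cderive1n n.+1 f = cderive1n n f'.
Proof.
move=> ff'; apply/funext => t; rewrite /cderive1n !derive1nSr.
congr (derive1n n _ t +i* derive1n n _ t); apply/funext => s; rewrite derive1E.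
  exact: (@derive_val _ _ _ _ _ _ _ (ff' s).1).
exact: (@derive_val _ _ _ _ _ _ _ (ff' s).2).
Qed.

Lemma cderive1n0 f : cderive1n 0 f = f.
Proof. by apply/funext => t; rewrite /cderive1n /=; case: (f t). Qed.

Lemma csmooth_cder n f t : csmooth f ->
  cder (cderive1n n f) t (cderive1n n.+1 f t).
Proof.
move=> /(_ n t)[f1 f2].
have E (F : R -> R) : derive1n n.+1 F t = 'D_1 (derive1n n F) t.
  by rewrite derive1nS derive1E.
split.
  change (is_derive t 1 (derive1n n (fun s => Re (f s)))
    (derive1n n.+1 (fun s => Re (f s)) t)).
  by apply: (is_derive_eq (derivableP f1)); rewrite E.
change (is_derive t 1 (derive1n n (fun s => Im (f s)))
  (derive1n n.+1 (fun s => Im (f s)) t)).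
by apply: (is_derive_eq (derivableP f2)); rewrite E.
Qed.

(** Exhibiting the whole chain of derivatives proves smoothness and identifies every [cderive1n n f]
    at once. *)
Lemma csmoothP f (F : nat -> R -> R[i]) :
  F 0 = f -> (forall n t, cder (F n) t (F n.+1 t)) ->
  csmooth f /\ forall n, cderive1n n f = F n.
Proof.
move=> F0 FS.
have H n : derive1n n (fun s : R => Re (f s)) = (fun s => Re (F n s)) /\
    derive1n n (fun s : R => Im (f s)) = (fun s => Im (F n s)).
  elim: n => [|n [IH1 IH2]]; first by rewrite F0.
  rewrite !derive1nS IH1 IH2; split; apply/funext => s; rewrite derive1E.
    exact: (@derive_val _ _ _ _ _ _ _ (FS n s).1).
  exact: (@derive_val _ _ _ _ _ _ _ (FS n s).2).
split.
  move=> n t; have [-> ->] := H n; have [H1 H2] := FS n t.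
  by split; exact: ex_derive.
move=> n; apply/funext => t; rewrite /cderive1n; have [-> ->] := H n.
by case: (F n t).
Qed.

Lemma csmooth_lin a f g : csmooth f -> csmooth g ->
  csmooth (fun t => a * f t + g t) /\ forall n,
  cderive1n n (fun t => a * f t + g t) =
  fun t => a * cderive1n n f t + cderive1n n g t.
Proof.
move=> sf sg.
apply: (csmoothP (F := fun n t => a * cderive1n n f t + cderive1n n g t)).
  by rewrite !cderive1n0.
move=> n t; apply: cderD; last exact: csmooth_cder.
apply: cder_eq; first by apply: cderM; [exact: cder_const|exact: csmooth_cder].
by rewrite mul0r add0r.
Qed.

Lemma le_normcM_pow (j : nat) t a b (x y : R) :
  `|t| ^+ j * normc a <= x -> `|t| ^+ j * normc b <= y ->
  `|t| ^+ j * normc (a + b) <= x + y.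
Proof.
move=> ax by_; apply: le_trans (lerD ax by_); rewrite -mulrDr.
by apply: ler_wpM2l; rewrite ?exprn_ge0//; exact: le_normcD.
Qed.

Lemma schwartz_lin a f g : schwartz f -> schwartz g ->
  schwartz (fun t => a * f t + g t).
Proof.
move=> [sf bf] [sg bg]; have [s e] := csmooth_lin a sf sg; split=> // j k.
have [C HC] := bf j k; have [D HD] := bg j k.
exists (normc a * C + D) => t; rewrite e; apply: le_normcM_pow => //.
rewrite Normc.normcM mulrCA; apply: ler_wpM2l => //; exact: normc_ge0.
Qed.

Lemma cderive1n_cst0 n : cderive1n n (fun=> 0 : R[i]) = fun=> 0.
Proof.
by have [_ ->] := @csmoothP (fun=> 0) (fun _ _ => 0) erefl (fun _ t => cder_const 0 t).
Qed.

Lemma schwartz0 : schwartz (fun=> 0 : R[i]).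
Proof.
have [s _] := @csmoothP (fun=> 0) (fun _ _ => 0) erefl (fun _ t => cder_const 0 t).
split=> // j k; exists 0 => t.
by rewrite cderive1n_cst0 Normc.normc0 mulr0.
Qed.

Lemma schwartz_scale a f : schwartz f -> schwartz (fun t => a * f t).
Proof.
move=> sf; rewrite (_ : (fun t => _) = fun t => a * f t + 0).
  exact: schwartz_lin sf schwartz0.
by apply/funext => t; rewrite addr0.
Qed.

(** * Seminorm estimates for tempered distributions *)

Section pairing.
Variable u : tempered_distribution R.

Lemma pairing0 : u (fun=> 0) = 0.
Proof.
have := pairing_linear u 1 schwartz0 schwartz0.
rewrite (_ : (fun t => _) = fun=> 0); last by apply/funext => t; rewrite mul1r addr0.
by rewrite mul1r => /eqP; rewrite -subr_eq0 opprD addNKr oppr_eq0 => /eqP.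
Qed.

Lemma pairing_scale a f : schwartz f -> u (fun t => a * f t) = a * u f.
Proof.
move=> sf; have := pairing_linear u a sf schwartz0.
rewrite pairing0 addr0 => <-; congr (u _).
by apply/funext => t; rewrite addr0.
Qed.

(** Continuity at 0 with tolerance 1, rescaled: multiplying f by d / (2 e) brings its seminorms down
    to d / 2 < d. The hypothesis on f is pointwise, so suprema need not be handled afterwards. *)
Lemma pairing_bound : exists (m : nat) (D : R), 0 <= D /\
  forall f (e : R), schwartz f -> 0 < e ->
  (forall j k t, (j <= m)%N -> (k <= m)%N ->
     `|t| ^+ j * normc (cderive1n k f t) <= e) ->
  normc (u f) <= D * e.
Proof.
have [m [d [d0 H]]] := pairing_continuous u schwartz0 ltr01.
exists m, (2 / d); split; first by rewrite divr_ge0// ltW.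
move=> f e sf e0 fe; pose c : R := d / (2 * e).
have c0 : 0 < c by rewrite divr_gt0// mulr_gt0.
have scf : schwartz (fun t => c%:C * f t) by exact: schwartz_scale.
have := H _ scf; rewrite pairing0 subr0 pairing_scale//.
rewrite Normc.normcM normc_real (gtr0_norm c0) => /(_ _).
rewrite -ltr_pdivlMl// mulr1 => h; apply/ltW.
suff -> : 2 / d * e = c^-1.
  apply: h => j k jm km.
  rewrite (_ : (fun t => _) = fun t => c%:C * f t); last first.
    by apply/funext => t; rewrite subr0.
  apply: (@le_lt_trans _ _ (d / 2)); last by rewrite ltr_pdivrMr// mulr_natr mulr2n ltrDl.
  rewrite /schwartz_seminorm; apply: ge_sup; first by by eexists; exists 0.
  move=> _ [t _ <-].
  have [_ e1] := csmooth_lin c%:C sf.1 schwartz0.1.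
  have -> : cderive1n k (fun t => c%:C * f t) t = c%:C * cderive1n k f t.
    rewrite (_ : (fun t => c%:C * f t) = fun t => c%:C * f t + 0); last first.
      by apply/funext => x; rewrite addr0.
    by rewrite e1 cderive1n_cst0 addr0.
  rewrite Normc.normcM normc_real (gtr0_norm c0) mulrCA.
  rewrite (_ : d / 2 = c * e); last by rewrite /c; field; rewrite gt_eqF.
  by rewrite (ler_pM2l c0); exact: fe.
by rewrite /c; field; rewrite !gt_eqF.
Qed.

End pairing.

Lemma MVT_bound (f f' : R -> R) (a b C : R) :
  (forall x : R, is_derive x 1 f (f' x)) ->
  (forall x, Num.min a b <= x <= Num.max a b -> `|f' x| <= C) ->
  `|f b - f a| <= C * `|b - a|.
Proof.
move=> df; wlog ab : a b / a <= b => [H C1|].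
  have [ab|/ltW ba] := leP a b; first exact: H.
  rewrite distrC [`|b - a|]distrC; apply: H => // x xab; apply: C1.
  by rewrite minC maxC.
rewrite (min_idPl ab) (max_idPr ab) => C1.
have [c cab ->] := MVT_segment ab (fun x _ => df x)
  (continuous_subspaceT (continuous_is_derive df)).
by rewrite normrM ler_wpM2r// C1// -in_itv.
Qed.

(** The mean value bound is applied to [f x - x * f' a] and then to [f']; losing the factor 1/2 is
    harmless. *)
Lemma taylor_bound (f f' f'' : R -> R) (a b C : R) : 0 <= C ->
  (forall x : R, is_derive x 1 f (f' x)) -> (forall x : R, is_derive x 1 f' (f'' x)) ->
  (forall x, Num.min a b <= x <= Num.max a b -> `|f'' x| <= C) ->
  `|f b - f a - (b - a) * f' a| <= C * (b - a) ^+ 2.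
Proof.
move=> C0 df df' f''C.
pose g x := f x - x * f' a.
have dg (x : R) : is_derive x 1 g (f' x - f' a).
  by rewrite /g; derive => /=; ring.
have := @MVT_bound g _ a b (C * `|b - a|) dg.
rewrite -mulrA -expr2 real_normK ?num_real//.
rewrite (_ : f b - f a - (b - a) * f' a = g b - g a); last by rewrite /g; ring.
apply => x /andP[ax xb].
have xab : `|x - a| <= `|b - a|.
  move: ax xb; have [ab|/ltW ba] := leP a b => ax xb.
    by rewrite !ger0_norm ?subr_ge0// lerD2r.
  by rewrite !ler0_norm ?subr_le0// lerN2 lerD2r.
apply: le_trans (ler_wpM2l C0 xab).
apply: (MVT_bound df') => y /andP[ay yx]; apply: f''C; apply/andP; split.
  apply: le_trans ay; rewrite le_min ax andbT ge_min lexx//.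
apply: (le_trans yx); rewrite ge_max xb andbT le_max lexx//.
Qed.

(** A converse to [taylor_bound]: a quadratic remainder is what a seminorm estimate yields for a
    pairing, and it suffices for differentiability. *)
Lemma is_derive_quadratic (f : R -> R) (a d C : R) :
  (forall h, `|h| <= 1 -> `|f (a + h) - f a - h * d| <= C * h ^+ 2) ->
  is_derive a 1 f d.
Proof.
move=> H.
have H' : h^-1 *: (f (h *: 1 + a) - f a) @[h --> 0^'] --> d.
  apply/cvgrPdist_le => e e0; near=> h.
  have h0 : h != 0 by near: h; exact: nbhs_dnbhs_neq.
  have h1 : `|h| <= 1.
    by near: h; apply: dnbhs0_le.
  have h2 : `|h| <= e / (`|C| + 1).
    by near: h; apply: dnbhs0_le; rewrite divr_gt0// ltr_wpDl.
  rewrite /GRing.scale/= mulr1 distrC.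
  rewrite (_ : _ - d = h^-1 * (f (a + h) - f a - h * d)); last first.
    by rewrite [h + a]addrC; field.
  rewrite normrM normfV ler_pdivrMl ?normr_gt0//.
  apply: (le_trans (H _ h1)); rewrite -(real_normK (num_real h)) expr2.
  rewrite mulrCA; apply: ler_wpM2l => //.
  apply: (@le_trans _ _ ((`|C| + 1) * `|h|)).
    by rewrite ler_wpM2r// (le_trans (ler_norm _))// lerDl.
  by rewrite -ler_pdivlMl 1?mulrC// ltr_wpDl.
apply: DeriveDef; first by apply/cvg_ex; exists d; exact: H'.
by apply/cvg_lim => //; exact: H'.
Unshelve. all: by end_near. Qed.

End complex_calculus.

(** * Gaussian wave packets along a ray *)

Section wave_packets.
Variables (R : realType) (x0 xi0 : R).
Local Notation normc := Normc.normc.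
Local Notation Re := complex.Re.
Local Notation Im := complex.Im.
Local Notation C := (R[i]).
Implicit Types (F G : R -> R -> C) (s t : R).

Definition moving_gaussian s t : C :=
  (expR (- (pi * (t - s * x0) ^+ 2)))%:C * expi (- (2 * pi * (s * xi0) * t)).

(* The class is closed under differentiation in [s] and in [t], and contains the
   time-frequency shifts of the Hermite functions by [s * (x0, xi0)]. *)
Inductive wave_packet : (R -> R -> C) -> Prop :=
| wave_packet_gaussian : wave_packet moving_gaussian
| wave_packet_affine (a b c : C) F : wave_packet F ->
    wave_packet (fun s t => (a + b * s%:C + c * t%:C) * F s t)
| wave_packet_add F G : wave_packet F -> wave_packet G ->
    wave_packet (fun s t => F s t + G s t).

Lemma wave_packet_scale (a : C) F : wave_packet F ->
  wave_packet (fun s t => a * F s t).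
Proof.
move=> wF; rewrite (_ : (fun s t => _) = fun s t => (a + 0 * s%:C + 0 * t%:C) * F s t).
  exact: wave_packet_affine.
by apply/funext => s; apply/funext => t; rewrite !mul0r !addr0.
Qed.

(** The mixed derivative is recorded in both orders: the induction on t-derivatives in
    [wave_packet_cderive] needs the s-derivative of [Ft] to be the t-derivative of [Fs]. *)
Lemma wave_packet_deriv F : wave_packet F -> exists Ft Fs Fst,
  [/\ wave_packet Ft, wave_packet Fs, wave_packet Fst & forall s t,
   [/\ cder (F s) t (Ft s t), cder (F ^~ t) s (Fs s t),
       cder (Ft ^~ t) s (Fst s t) & cder (Fs s) t (Fst s t)]].
Proof.
have daff (a b c : C) (f : R -> C) (t : R) z : cder f t z ->
    cder (fun s => (a + b * s%:C + c) * f s) t ((a + b * t%:C + c) * z + b * f t).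
  move=> fz; apply: cder_eq.
    apply: cderM; last exact: fz.
    apply: cderD; last exact: cder_const.
    apply: cderD; first exact: cder_const.
    by apply: cderM; [exact: cder_const|exact: cder_id].
  by rewrite /=; ring.
have dafft (a b c : C) (f : R -> C) (t s : R) z : cder f t z ->
    cder (fun t => (a + b * s%:C + c * t%:C) * f t) t
         ((a + b * s%:C + c * t%:C) * z + c * f t).
  move=> fz; apply: cder_eq.
    apply: cderM; last exact: fz.
    apply: cderD; first exact: cder_const.
    by apply: cderM; [exact: cder_const|exact: cder_id].
  by rewrite /=; ring.
have daffs (a b c : C) (f : R -> C) (t s : R) z : cder f s z ->
    cder (fun s => (a + b * s%:C + c * t%:C) * f s) s
         ((a + b * s%:C + c * t%:C) * z + b * f s).
  exact: daff.
elim=> [|a b c G wG [Gt [Gs [Gst [wGt wGs wGst D]]]]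
        |G H _ [Gt [Gs [Gst [wGt wGs wGst DG]]]] _ [Ht [Hs [Hst [wHt wHs wHst DH]]]]].
(* The exponent is -pi (t - s x0)^2 - 2 pi i s xi0 t. Its derivative in t is m s + l t, and in s it
   is n s + m t. *)
- pose l : C := - (2 * pi)%:C.
  pose m : C := (2 * pi)%:C * (x0 -i* xi0).
  pose n : C := - (2 * pi * x0 ^+ 2)%:C.
  pose E := moving_gaussian.
  pose Et s t := (0 + m * s%:C + l * t%:C) * E s t.
  pose Es s t := (0 + n * s%:C + m * t%:C) * E s t.
  have wE := wave_packet_gaussian.
  have dEt s t : cder (E s) t (Et s t).
    apply: cder_eq.
      apply: cderM.
        by notypeclasses refine (cder_real _); derive_rules.
      rewrite (_ : (fun t => _) = (fun t => expi (- (2 * pi * (s * xi0)) * t)));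
        last by apply/funext => ?; congr expi; ring.
      exact: cder_expi.
    rewrite /Et /E /moving_gaussian mulNr.
    set g := expR _; set e := expi _.
    by apply: eqC; rewrite !(ReM, ImM, ReD, ImD, ReN, ImN) /=; ring.
  have dEs s t : cder (E ^~ t) s (Es s t).
    apply: cder_eq.
      apply: cderM.
        by notypeclasses refine (cder_real _); derive_rules.
      rewrite (_ : (fun t => _) = (fun s => expi (- (2 * pi * xi0 * t) * s)));
        last by apply/funext => ?; congr expi; ring.
      exact: cder_expi.
    rewrite /Es /E /moving_gaussian.
    rewrite (_ : - (2 * pi * xi0 * t) * s = - (2 * pi * (s * xi0) * t)); last by ring.
    set g := expR _; set e := expi _.
    by apply: eqC; rewrite !(ReM, ImM, ReD, ImD, ReN, ImN) /=; ring.
  exists Et, Es, (fun s t => (0 + m * s%:C + l * t%:C) * Es s t + m * E s t).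
  split.
  + exact: wave_packet_affine.
  + exact: wave_packet_affine.
  + apply: wave_packet_add; last exact: wave_packet_scale.
    by apply: wave_packet_affine; exact: wave_packet_affine.
  + move=> s t; split => //.
      exact: daffs.
    apply: cder_eq; first exact: dafft.
    by rewrite /Es /Et; ring.
- exists (fun s t => (a + b * s%:C + c * t%:C) * Gt s t + c * G s t),
   (fun s t => (a + b * s%:C + c * t%:C) * Gs s t + b * G s t),
   (fun s t => (a + b * s%:C + c * t%:C) * Gst s t + (b * Gt s t + c * Gs s t)).
  split.
  + by apply: wave_packet_add; [exact: wave_packet_affine|exact: wave_packet_scale].
  + by apply: wave_packet_add; [exact: wave_packet_affine|exact: wave_packet_scale].
  + apply: wave_packet_add; first exact: wave_packet_affine.
    by apply: wave_packet_add; exact: wave_packet_scale.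
  + move=> s t; have [D1 D2 D3 D4] := D s t; split.
    * exact: dafft.
    * exact: daffs.
    * apply: cder_eq; first apply: cderD; first exact: (daffs _ _ _ _ _ _ _ D3).
        by apply: cderM; [exact: cder_const|exact: D2].
      by rewrite /=; ring.
    * apply: cder_eq; first apply: cderD; first exact: (dafft _ _ _ _ _ _ _ D4).
        by apply: cderM; [exact: cder_const|exact: D1].
      by rewrite /=; ring.
- exists (fun s t => Gt s t + Ht s t), (fun s t => Gs s t + Hs s t),
    (fun s t => Gst s t + Hst s t).
  split; [exact: wave_packet_add..|].
  move=> s t; have [? ? ? ?] := DG s t; have [? ? ? ?] := DH s t.
  by split; exact: cderD.
Qed.

End wave_packets.

(** One plus the sum of the absolute values of the finitely many individual constants serves all
    index pairs; it merges the seminorms occurring in [pairing_bound]. *)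
Lemma uniform_bound (R : realType) (p : nat -> nat -> R -> Prop) m :
  (forall j k x y, x <= y -> p j k x -> p j k y) ->
  (forall j k, exists x, p j k x) ->
  exists2 x, 0 < x & forall j k, (j <= m)%N -> (k <= m)%N -> p j k x.
Proof.
move=> pmono pex.
have /choice[c pc] : forall jk : nat * nat, exists x, p jk.1 jk.2 x.
  by case=> j k; exact: pex.
exists (1 + \sum_(j < m.+1) \sum_(k < m.+1) `|c (j : nat, k : nat)|).
  by rewrite ltr_pwDl// sumr_ge0// => j _; rewrite sumr_ge0.
move=> j k jm km; apply: pmono (pc (j, k)).
have jm' : (j < m.+1)%N by [].
have km' : (k < m.+1)%N by [].
rewrite (bigD1 (Ordinal jm'))//= (bigD1 (Ordinal km'))//=.
set A := \sum_(i < _ | _) _; set B := \sum_(i < _ | _) _.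
have A0 : 0 <= A by exact: sumr_ge0.
have B0 : 0 <= B by apply: sumr_ge0 => i _; exact: sumr_ge0.
by have := ler_norm (c (j, k)); lra.
Qed.

(** * Seminorms of wave packets and derivatives of pairings along a ray *)

Section wave_packet_bounds.
Variables (R : realType) (x0 xi0 : R).
Local Notation normc := Normc.normc.
Local Notation Re := complex.Re.
Local Notation Im := complex.Im.
Local Notation C := (R[i]).
Implicit Types (F G : R -> R -> C) (s t : R).

Local Notation wave_packet := (wave_packet x0 xi0).

(** For the Gaussian, pi (t - x)^2 >= pi t^2 / 2 - pi x^2 separates the centre x = s x0 from t. An
    affine factor costs one more power of |t|. *)
Lemma wave_packet_bounded F : wave_packet F -> forall (j : nat) (S : R), 0 <= S ->
  exists B : R, 0 <= B /\ forall s t, `|s| <= S -> `|t| ^+ j * normc (F s t) <= B.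
Proof.
have pi2 : 0 < pi / 2 :> R by rewrite divr_gt0// pi_gt0.
elim=> [|a b c G _ IH|G H _ IG _ IH] j S S0.
- have [B [B0 HB]] := pow_gauss_bounded j pi2.
  exists (expR (pi * (S * x0) ^+ 2) * B); split.
    by rewrite mulr_ge0 ?expR_ge0.
  move=> s t sS; rewrite /moving_gaussian Normc.normcM normc_expi mulr1 normc_real.
  rewrite [`|expR _|]ger0_norm ?expR_ge0//.
  apply: (@le_trans _ _ (expR (pi * (S * x0) ^+ 2) *
      (`|t| ^+ j * expR (- (pi / 2 * t ^+ 2))))); last first.
    by rewrite ler_wpM2l ?expR_ge0.
  rewrite [leRHS]mulrCA ler_wpM2l ?exprn_ge0// -expRD ler_expR.
  have s2 : (s * x0) ^+ 2 <= (S * x0) ^+ 2.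
    rewrite -(real_normK (num_real (s * x0))) -(real_normK (num_real (S * x0))).
    by rewrite lerXn2r ?nnegrE// !normrM ler_wpM2r// (le_trans sS)// ler_norm.
  move: (S * x0) (s * x0) s2 => y x xy.
  have pi0 := pi_gt0 R; move: pi pi0 => p p0.
  have : 0 <= p * (t / 2 - x) ^+ 2 by rewrite mulr_ge0 ?sqr_ge0// ltW.
  by nra.
- have [B [B0 HB]] := IH j S S0; have [D [D0 HD]] := IH j.+1 S S0.
  exists ((normc a + normc b * S) * B + normc c * D); split.
    by rewrite addr_ge0 ?mulr_ge0 ?addr_ge0 ?mulr_ge0 ?normc_ge0.
  move=> s t sS; rewrite mulrDl; apply: le_normcM_pow.
    rewrite Normc.normcM mulrCA; apply: ler_pM; rewrite ?normc_ge0//.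
      by rewrite mulr_ge0 ?exprn_ge0 ?normc_ge0.
    rewrite (le_trans (le_normcD _ _))// lerD2l Normc.normcM normc_real.
    by rewrite ler_wpM2l ?normc_ge0//.
    exact: HB.
  rewrite !Normc.normcM normc_real -[normc c * _ * _]mulrA [leLHS]mulrCA ler_wpM2l ?normc_ge0//.
  by rewrite mulrA -exprSr; exact: HD.
- have [B [B0 HB]] := IG j S S0; have [D [D0 HD]] := IH j S S0.
  exists (B + D); split; first by rewrite addr_ge0.
  by move=> s t sS; apply: le_normcM_pow; [exact: HB|exact: HD].
Qed.

Lemma wave_packet_cderive n F Fs : wave_packet F -> wave_packet Fs ->
  (forall s t, cder (F ^~ t) s (Fs s t)) ->
  [/\ wave_packet (fun s => cderive1n n (F s)),
      wave_packet (fun s => cderive1n n (Fs s)) &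
      forall s t, cder (fun s => cderive1n n (F s) t) s (cderive1n n (Fs s) t)].
Proof.
elim: n F Fs => [|n IH] F Fs wF wFs FFs.
  have E G : (fun s => cderive1n 0 (G s)) = G.
    by apply/funext => s; rewrite cderive1n0.
  rewrite !E; split; [by []|by []|move=> s t].
  by under eq_fun do rewrite cderive1n0; rewrite cderive1n0.
have [Ft [Fs' [Fst [wFt wFs' wFst D]]]] := wave_packet_deriv wF.
have eFs : Fs' = Fs.
  apply/funext => s; apply/funext => t.
  by have [_ h _ _] := D s t; exact: cder_unique h (FFs s t).
have e1 s : cderive1n n.+1 (F s) = cderive1n n (Ft s).
  by apply: cderive1nSr => t; case: (D s t).
have e2 s : cderive1n n.+1 (Fs s) = cderive1n n (Fst s).
  by apply: cderive1nSr => t; rewrite -eFs; case: (D s t).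
have [|h1 h2 h3] := IH Ft Fst wFt wFst; first by move=> s t; case: (D s t).
by rewrite (funext e1) (funext e2); split => // s t; rewrite e2; under eq_fun do rewrite e1.
Qed.

Lemma wave_packet_schwartz F s : wave_packet F -> schwartz (F s).
Proof.
move=> wF; have [Ft [Fs [Fst [wFt wFs wFst D]]]] := wave_packet_deriv wF.
have W n : wave_packet (fun s => cderive1n n (F s)).
  by have [] := @wave_packet_cderive n F Fs wF wFs (fun s t => let: And4 _ h _ _ := D s t in h).
split.
  move=> n t; have [Gt [_ [_ [_ _ _ /(_ s t)[[h1 h2] _ _ _]]]]] := wave_packet_deriv (W n).
  by split; [exact: (@ex_derive _ _ _ _ _ _ _ h1)|exact: (@ex_derive _ _ _ _ _ _ _ h2)].
move=> j k; have [B [_ HB]] := wave_packet_bounded (W k) j (normr_ge0 s).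
by exists B => t; exact: HB.
Qed.

Section pairing_along_path.
Variable u : tempered_distribution R.

(** The remainder F(s+h) - F(s) - h Fs(s) is Taylor-expanded in s inside each seminorm, with second
    derivative bounded for parameters up to |s| + 1. Real and imaginary parts contribute B h^2 each,
    and [pairing_bound] transfers the estimate to u. *)
Lemma cder_pairing F Fs s : wave_packet F -> wave_packet Fs ->
  (forall s t, cder (F ^~ t) s (Fs s t)) ->
  cder (fun s => u (F s)) s (u (Fs s)).
Proof.
move=> wF wFs FFs.
have [Fst [Fss [Fsst [_ wFss _ Dss]]]] := wave_packet_deriv wFs.
have FsFss x t : cder (Fs ^~ t) x (Fss x t) by case: (Dss x t).
have [m [D [D0 HD]]] := pairing_bound u.
have S0 : 0 <= `|s| + 1 by rewrite addr_ge0.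
pose p j k (x : R) := 0 <= x /\ forall s' t, `|s'| <= `|s| + 1 ->
  `|t| ^+ j * normc (cderive1n k (Fss s') t) <= x.
have [||B B0 HB] := @uniform_bound R p m.
- move=> j k x y xy [x0' H]; split; first exact: le_trans xy.
  by move=> s' t s's; exact: le_trans (H _ _ s's) xy.
- move=> j k; have [Gt [Gs [Gst [_ wGs _ DG]]]] := wave_packet_deriv wFss.
  have [w _ _] := @wave_packet_cderive k Fss Gs wFss wGs
     (fun s t => let: And4 _ h _ _ := DG s t in h).
  by have [B [B0 HB]] := wave_packet_bounded w j S0; exists B; split.
pose r h := u (F (s + h)) - u (F s) - h%:C * u (Fs s).
have rB h : `|h| <= 1 -> normc (r h) <= D * (2 * B) * h ^+ 2.
  (* The case h = 0 is separate because [pairing_bound] asks for a positive bound. *)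
  move=> h1; have [->|hn0] := eqVneq h 0.
    rewrite /r addr0 subrr sub0r mul0r oppr0 Normc.normc0.
    by rewrite expr0n mulr0.
  have h2 : 0 < h ^+ 2 by rewrite exprn_even_gt0.
  have sF x := wave_packet_schwartz x wF; have sFs x := wave_packet_schwartz x wFs.
  have -> : r h = u (fun t => (- h%:C) * Fs s t + (-1 * F s t + F (s + h) t)).
    rewrite !pairing_linear//; last exact: schwartz_lin.
    by rewrite /r; ring.
  rewrite -mulrA; apply: HD => //.
  - by apply: schwartz_lin => //; exact: schwartz_lin.
  - by rewrite mulr_gt0// mulr_gt0.
  move=> j k t jm km.
  have [_ ->] := csmooth_lin (- h%:C) (sFs s).1 (schwartz_lin (-1) (sF s) (sF (s + h))).1.
  have [_ ->] := csmooth_lin (-1) (sF s).1 (sF (s + h)).1.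
  have [_ _ d1] := @wave_packet_cderive k F Fs wF wFs FFs.
  have [_ _ d2] := @wave_packet_cderive k Fs Fss wFs wFss FsFss.
  have bnd x : Num.min s (s + h) <= x <= Num.max s (s + h) ->
      `|t| ^+ j * normc (cderive1n k (Fss x) t) <= B.
    move=> sx; have [_] := HB j k jm km; apply.
    have xs : `|x - s| <= 1.
      move: sx h1; case: (leP s (s + h)) => _ /andP[];
        by rewrite !ler_norml => ? ? /andP[? ?]; apply/andP; split; lra.
    by rewrite -[x](subrK s) (le_trans (ler_normD _ _))// addrC lerD2l.
  set tj := `|t| ^+ j.
  have tj0 : 0 <= tj by rewrite exprn_ge0.
  have scal (f : R -> R) (x d : R) : is_derive x 1 f d ->
      is_derive x 1 (fun x => tj * f x) (tj * d).
    by move=> fg; derive; rewrite /=; ring.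
  have bRe : `|tj * Re (cderive1n k (F (s + h)) t) - tj * Re (cderive1n k (F s) t) -
      h * (tj * Re (cderive1n k (Fs s) t))| <= B * h ^+ 2.
    have := @taylor_bound _ (fun x => tj * Re (cderive1n k (F x) t))
      (fun x => tj * Re (cderive1n k (Fs x) t)) (fun x => tj * Re (cderive1n k (Fss x) t))
      s (s + h) B (ltW B0).
    rewrite (_ : s + h - s = h); last by ring.
    apply => [x|x|x sx].
    + exact (scal _ _ _ (d1 x t).1).
    + exact (scal _ _ _ (d2 x t).1).
    + rewrite normrM (ger0_norm tj0) (le_trans _ (bnd x sx))//.
      by rewrite ler_wpM2l// normc_Re.
  have bIm : `|tj * Im (cderive1n k (F (s + h)) t) - tj * Im (cderive1n k (F s) t) -
      h * (tj * Im (cderive1n k (Fs s) t))| <= B * h ^+ 2.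
    have := @taylor_bound _ (fun x => tj * Im (cderive1n k (F x) t))
      (fun x => tj * Im (cderive1n k (Fs x) t)) (fun x => tj * Im (cderive1n k (Fss x) t))
      s (s + h) B (ltW B0).
    rewrite (_ : s + h - s = h); last by ring.
    apply => [x|x|x sx].
    + exact (scal _ _ _ (d1 x t).2).
    + exact (scal _ _ _ (d2 x t).2).
    + rewrite normrM (ger0_norm tj0) (le_trans _ (bnd x sx))//.
      by rewrite ler_wpM2l// normc_Im.
  apply: le_trans (ler_wpM2l tj0 (normc_le _)) _.
  have e (z : R) : tj * `|z| = `|tj * z| by rewrite normrM ger0_norm.
  rewrite mulrDr !e.
  rewrite [leRHS](_ : _ = B * h ^+ 2 + B * h ^+ 2); last by ring.
  apply: lerD; [move: bRe|move: bIm];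
    rewrite !(ReD, ReM, ImD, ImM, ReN, ImN) /=; congr (`|_| <= _); ring.
split; apply: (@is_derive_quadratic _ _ _ _ (D * (2 * B))) => h h1.
  by have := le_trans (normc_Re _) (rB h h1); rewrite /r !(ReD, ReN, ReM) /= mul0r subr0.
by have := le_trans (normc_Im _) (rB h h1); rewrite /r !(ImD, ImN, ImM) /= mul0r addr0.
Qed.

End pairing_along_path.
End wave_packet_bounds.

(** * Transfer of averages *)

Section tauberian.
Variables (R : realType) (I : Type) (x : I -> nat -> R -> R) (y : nat -> R).
Let T i n s := \sum_(k < n) x i k s.
Let tau n := \sum_(k < n) y k.
Variables (D : I -> nat -> R -> R) (c C : R) (e : nat).
Hypothesis x_ge0 : forall i k s, 0 <= x i k s.
Hypothesis dT : forall i n (s : R), is_derive s 1 (T i n) (D i n s).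
Hypothesis c_ge0 : 0 <= c.
Hypothesis DT : forall i n s, 0 <= s <= 1 ->
  `|D i n s| <= c * Num.sqrt n%:R * (x i n.-1 s + x i n s).
Hypothesis xC : forall i k s, 0 <= s <= 1 -> x i k s <= C * k.+1%:R ^+ e.
Hypothesis x0 : forall i k, x i k 0 = y k.
Hypothesis y_ge0 : forall k, 0 <= y k.

Let T_mono i m n s : (m <= n)%N -> T i m s <= T i n s.
Proof.
by move=> mn; rewrite /T -(subnKC mn) big_split_ord/= lerDl sumr_ge0.
Qed.

Let T0 i n : T i n 0 = tau n.
Proof. by apply: eq_bigr => k _; exact: x0. Qed.

(** The index [i] will be the direction of the ray. The constants do not depend on it, which is the
    source of uniformity in z. *)
Lemma window_bound i n L s M : (0 < n)%N -> 0 <= s <= 1 ->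
  (forall s', 0 <= s' <= 1 -> T i (n + L) s' <= M) ->
  `|\sum_(j < L) T i (n + j) s - \sum_(j < L) tau (n + j)| <=
    2 * c * Num.sqrt (n + L)%:R * M.
Proof.
move=> n0 /andP[s0 s1] TM.
have dA (a : R) : is_derive a 1 (fun a : R => \sum_(j < L) T i (n + j) a)
    (\sum_(j < L) D i (n + j) a).
  rewrite (_ : (fun a : R => _) = \sum_(j < L) T i (n + j)).
    exact: is_derive_sum.
  by apply/funext => a'; rewrite fct_sumE.
have M0 : 0 <= M.
  by apply: le_trans (TM 0 _); rewrite ?lexx ?ler01// sumr_ge0.
have -> : \sum_(j < L) tau (n + j) = \sum_(j < L) T i (n + j) 0.
  by apply: eq_bigr => j _; rewrite T0.
have := @MVT_bound _ _ _ 0 s (2 * c * Num.sqrt (n + L)%:R * M) dA.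
rewrite (min_idPl s0) (max_idPr s0) subr0 (ger0_norm s0) => H.
apply: (le_trans (H _)); last first.
  by rewrite ler_piMr// !mulr_ge0 ?sqrtr_ge0.
move=> a /andP[a0 a1]; have a01 : 0 <= a <= 1 by rewrite a0 (le_trans a1).
apply: (le_trans (ler_norm_sum _ _ _)).
apply: (@le_trans _ _ (\sum_(j < L) c * Num.sqrt (n + L)%:R *
   (x i (n + j).-1 a + x i (n + j) a))).
  apply: ler_sum => j _; apply: (le_trans (DT _ _ a01)).
  rewrite ler_wpM2r ?addr_ge0// ler_wpM2l// ler_sqrt ?ler0n// ler_nat leq_add2l ltnW//.
rewrite -mulr_sumr.
have -> : 2 * c * Num.sqrt (n + L)%:R * M = c * Num.sqrt (n + L)%:R * (M + M).
  by ring.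
(* Both sums run over distinct indices below n + L, so each is part of [T i (n + L)]; positivity of
   n keeps the predecessors distinct. *)
rewrite ler_wpM2l ?mulr_ge0 ?sqrtr_ge0// big_split/= lerD//.
  apply: le_trans (TM _ a01); case: n n0 {H dA TM} => // n _.
  apply: (@le_trans _ _ (T i (n + L) a)).
    by rewrite /T big_split_ord/= lerDr sumr_ge0.
  by apply: T_mono; rewrite addSn.
by apply: le_trans (TM _ a01); rewrite /T big_split_ord/= lerDr sumr_ge0.
Qed.

(** Partial sums increase with n: the window sum at s is at least L times its first term, and the
    one at 0 is at most L [tau (n + L)]. *)
Lemma window_upper i n L s M : (0 < n)%N -> (0 < L)%N -> 0 <= s <= 1 ->
  (forall s', 0 <= s' <= 1 -> T i (n + L) s' <= M) ->
  T i n s <= tau (n + L) + 2 * c * Num.sqrt (n + L)%:R * M / L%:R.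
Proof.
move=> n0 L0 s01 TM; have L0' : 0 < L%:R :> R by rewrite ltr0n.
rewrite -(ler_pM2l L0') mulrDr [L%:R * (_ / _)]mulrC divfK ?gt_eqF//.
have := window_bound n0 s01 TM; rewrite ler_norml => /andP[_].
rewrite lerBlDr => h; apply: (@le_trans _ _ (\sum_(j < L) T i (n + j) s)).
  by rewrite mulr_natl -[L in _ *+ L]card_ord -sumr_const ler_sum// => j _;
    apply: T_mono; rewrite leq_addr.
apply: (le_trans h); rewrite addrC lerD2r mulr_natl -[L in _ *+ L]card_ord -sumr_const
  ler_sum// => j _.
by rewrite -!(T0 i) T_mono// leq_add2l ltnW.
Qed.

Lemma window_lower i n L s M : (0 < n)%N -> (0 < L)%N -> 0 <= s <= 1 ->
  (forall s', 0 <= s' <= 1 -> T i (n + L) s' <= M) ->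
  tau n - 2 * c * Num.sqrt (n + L)%:R * M / L%:R <= T i (n + L) s.
Proof.
move=> n0 L0 s01 TM; have L0' : 0 < L%:R :> R by rewrite ltr0n.
rewrite -(ler_pM2l L0') mulrBr [L%:R * (_ / _)]mulrC divfK ?gt_eqF//.
have := window_bound n0 s01 TM; rewrite ler_norml => /andP[+ _].
rewrite lerBrDr lerBlDr addrC => h.
apply: (@le_trans _ _ (\sum_(j < L) tau (n + j))).
  by rewrite mulr_natl -[L in _ *+ L]card_ord -sumr_const ler_sum// => j _;
    rewrite -!(T0 i) T_mono// leq_addr.
rewrite -lerBlDr; apply: (@le_trans _ _ (\sum_(j < L) T i (n + j) s)); first lra.
rewrite mulr_natl -[L in _ *+ L]card_ord -sumr_const ler_sum// => j _.
by rewrite T_mono// leq_add2l ltnW.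
Qed.

(* Each step of the induction on [q] lowers the growth exponent by 1/2. *)
Lemma linear_growth (Y : R) : (forall n, tau n <= Y * n%:R) ->
  exists2 B : R, 0 <= B & forall i n s, (0 < n)%N -> 0 <= s <= 1 ->
    T i n s <= B * n%:R.
Proof.
move=> tauY; suff: forall q, exists2 B : R, 0 <= B & forall i n s, (0 < n)%N -> 0 <= s <= 1 ->
    T i n s <= B * (n%:R * Num.sqrt n%:R ^+ (2 * e - q)).
  move=> /(_ (2 * e)%N)[B B0 HB]; exists B => // i n s n0 s01.
  by have := HB i n s n0 s01; rewrite subnn expr0 mulr1.
elim=> [|q [B B0 IH]].
  exists `|C| => // i n s n0 s01; rewrite subn0 exprM sqrtn_sqr.
  rewrite mulrCA mulr_natl -[X in _ *+ X]card_ord -sumr_const.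
  apply: ler_sum => k _; apply: (le_trans (xC _ _ s01)).
  apply: le_trans (ler_wpM2r _ (ler_norm C)) _; first by rewrite exprn_ge0.
  by rewrite ler_wpM2l// lerXn2r ?nnegrE// ler_nat.
pose r := Num.sqrt 2%:R : R.
exists (2 * `|Y| + 4 * c * B * r * r ^+ (2 * e - q)).
  by rewrite addr_ge0 ?mulr_ge0 ?exprn_ge0 ?sqrtr_ge0.
move=> i n s n0 s01.
have n1 : 1 <= Num.sqrt n%:R :> R by rewrite -[leLHS]sqrtr1 ler_sqrt ?ler1n.
have nn : (n + n)%:R = 2 * n%:R :> R by rewrite natrD mulr_natl mulr2n.
have snn : Num.sqrt (n + n)%:R = r * Num.sqrt n%:R by rewrite nn sqrtrM.
have := window_upper n0 n0 s01 (IH i (n + n)%N ^~ (ltn_addr n n0)).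
move=> h; apply: (le_trans h); rewrite [leRHS]mulrDl; apply: lerD.
  apply: (le_trans (tauY _)); rewrite nn mulrCA -!mulrA ler_wpM2l//.
  apply: le_trans (ler_wpM2r _ (ler_norm Y)) _ => //.
  by rewrite ler_wpM2l// ler_peMr// exprn_ege1.
have n0' : n%:R != 0 :> R by rewrite pnatr_eq0 -lt0n.
rewrite snn nn; set a := Num.sqrt n%:R; set k := (2 * e - q)%N.
have -> : 2 * c * (r * a) * (B * (2 * n%:R * (r * a) ^+ k)) / n%:R =
    4 * c * B * r * r ^+ k * a ^+ k.+1 by rewrite exprMn exprS; field.
rewrite ler_wpM2l ?mulr_ge0 ?exprn_ge0 ?sqrtr_ge0//.
(* Once the exponent is 0, truncated subtraction keeps it there, and a <= a^2 closes that case. *)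
rewrite -(sqrtn_sqr R n) -/a -exprD ler_weXn2l// /k subnS.
by case: (2 * e - q)%N => [|p]; rewrite // addnC addn2.
Qed.

Lemma nat_above (r : R) : exists N : nat, r <= N%:R.
Proof. by exists (Num.truncn r).+1; rewrite ltW// real_truncnS_gt// num_real. Qed.

Lemma uniform_average :
  (forall eta, 0 < eta -> exists N, forall n, (N <= n)%N ->
     `|tau n - n%:R| <= eta * n%:R) ->
  forall eps, 0 < eps -> exists N, forall n i s, (N <= n)%N -> 0 <= s <= 1 ->
     `|T i n s - n%:R| <= eps * n%:R.
Proof.
move=> htau.
have [N1 HN1] := htau 1 ltr01.
have tau_mono m n : (m <= n)%N -> tau m <= tau n.
  by move=> mn; rewrite /tau -(subnKC mn) big_split_ord/= lerDl sumr_ge0.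
(* Up to [N1], [tau n] is at most [tau N1]; beyond it, the hypothesis with eta = 1 gives 2 n. *)
have tauY n : tau n <= (2 + tau N1) * n%:R.
  have t0 k : 0 <= tau k by rewrite sumr_ge0.
  case: n => [|n]; first by rewrite /tau big_ord0 mulr0.
  have [nN|/ltnW Nn] := leqP n.+1 N1.
    apply: le_trans (tau_mono _ _ nN) _.
    have n1 : 1 <= n.+1%:R :> R by rewrite ler1n.
    by have := t0 N1; nra.
  have := HN1 _ Nn; rewrite ler_norml mul1r => /andP[_ h].
  have n1 : 0 <= n.+1%:R :> R by [].
  by have := t0 N1; nra.
have [B B0 HB] := linear_growth tauY.
move=> eps eps0.
(* [d] is the relative window length: K is about 1/d and L about n/K, so that n <= K L and L <= 2 d
   n. *)
pose d : R := Num.min (eps / 8) 8^-1.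
have d0 : 0 < d by rewrite lt_min divr_gt0//= invr_gt0.
have deps : 8 * d <= eps.
  have : d <= eps / 8; [by rewrite ge_min lexx|lra].
have d8 : 8 * d <= 1.
  have : d <= 8^-1; [by rewrite ge_min lexx orbT|lra].
have [N0 HN0] := htau d d0.
pose K := (Num.truncn d^-1).+1.
have Kd : 1 <= K%:R * d.
  by rewrite -ler_pdivrMr// mul1r ltW// real_truncnS_gt// num_real.
have K0 : 0 < K%:R :> R by rewrite ltr0n.
(* The window error is at most b sqrt(n): use sqrt(n+L) <= 2 sqrt(n), n + L <= 2 n and n / L <= K.
   It is below d n once n >= (b/d)^2. *)
pose b := 8 * c * B * K%:R.
have b0 : 0 <= b by rewrite !mulr_ge0.
have [N2 HN2] := nat_above ((b / d) ^+ 2).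
have [N3 HN3] := nat_above d^-1.
exists (N2 + N3 + 2 * N0 + 4)%N => n i s nN s01.
have [nN2 nN3 nN0 n4] : [/\ N2 <= n, N3 <= n, 2 * N0 <= n & 4 <= n]%N.
  by move: nN; clear; split; lia.
have n2 : (b / d) ^+ 2 <= n%:R.
  by apply: (le_trans HN2); rewrite ler_nat.
have n3 : 1 <= d * n%:R.
  rewrite -ler_pdivrMl// mulr1; apply: (le_trans HN3).
  by rewrite ler_nat.
have n0 : 0 < n%:R :> R by rewrite ltr0n; exact: leq_trans n4.
pose L := (n %/ K).+1.
have L0 : (0 < L)%N by [].
have L0' : 0 < L%:R :> R by rewrite ltr0n.
have nKL : n%:R <= K%:R * L%:R :> R.
  by rewrite -natrM ler_nat mulnC ltnW// /L -ltn_divLR.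
have Ld : L%:R <= 2 * d * n%:R.
  have : (L - 1)%:R * K%:R <= n%:R :> R.
    by rewrite -natrM ler_nat /L subn1 /= leq_trunc_div.
  rewrite natrB// => h; have : (L%:R - 1) <= d * n%:R.
    have : (L%:R - 1) * K%:R * d <= n%:R * d by rewrite ler_wpM2r// ltW.
    have : 0 <= L%:R - 1 :> R by rewrite subr_ge0 ler1n.
    by nra.
  lra.
clearbody L; have Ln : (2 * L <= n)%N.
  by rewrite -(ler_nat R) natrM; nra.
pose a := Num.sqrt n%:R : R.
have a0 : 0 <= a by rewrite sqrtr_ge0.
have aa : a ^+ 2 = n%:R by rewrite sqrtn_sqr.
have ba : b * a <= d * n%:R.
  have h : b / d <= a.
    by rewrite -(ler_pXn2r (n := 2)) ?nnegrE ?divr_ge0 ?(ltW d0)// aa.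
  by move: h; rewrite ler_pdivrMr// -aa => h; nra.
rewrite ler_norml; apply/andP; split.
(* For the lower bound the window starts at n - L, so that it ends at n. *)
- have [nL nL0 nLN nL1] : [/\ (n - L + L = n), 0 < n - L, N0 <= n - L & L <= n]%N.
    by move: Ln nN0 n4 L0; clear; split; lia.
  have := @window_lower i (n - L) L s (B * n%:R) nL0 L0 s01.
  rewrite nL => /(_ (fun s' => HB i n s' (leq_trans nL0 (leq_subr _ _)))).
  have := HN0 _ nLN; rewrite ler_norml natrB// => /andP[h1 _] h2.
  have h3 : 2 * c * Num.sqrt n%:R * (B * n%:R) / L%:R <= b * a.
    rewrite ler_pdivrMr// -/a /b.
    have : c * a * B * n%:R <= c * a * B * (K%:R * L%:R).
      by rewrite ler_wpM2l// !mulr_ge0.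
    have : 0 <= c * a * B * (K%:R * L%:R) by rewrite !mulr_ge0.
    by nra.
  have : 0 <= d * L%:R by rewrite mulr_ge0// ltW.
  by move: h1 h2 h3; nra.
- have := @window_upper i n L s (B * (n + L)%:R) _ L0 s01.
  have [nL0 nLN nL1 nL4] : [/\ 0 < n + L, N0 <= n + L, n + L <= 2 * n & n + L <= 2 ^ 2 * n]%N.
    by move: Ln nN0 n4 L0; clear; split; lia.
  rewrite -{1}(ltr0n R) => /(_ n0 (fun s' => HB i (n + L)%N s' nL0)) h2.
  have := HN0 _ nLN; rewrite ler_norml => /andP[_ h1].
  have h3 : 2 * c * Num.sqrt (n + L)%:R * (B * (n + L)%:R) / L%:R <= b * a.
    have k1 : Num.sqrt (n + L)%:R <= 2 * a.
      rewrite -(ler_pXn2r (n := 2)) ?nnegrE ?sqrtr_ge0 ?mulr_ge0// sqrtn_sqr exprMn aa.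
      by rewrite -natrX -natrM ler_nat.
    have k2 : (n + L)%:R <= 2 * n%:R :> R by rewrite -natrM ler_nat.
    rewrite ler_pdivrMr//.
    apply: (@le_trans _ _ (2 * c * (2 * a) * (B * (2 * n%:R)))).
      by apply: ler_pM; rewrite ?mulr_ge0 ?sqrtr_ge0// ler_wpM2l// mulr_ge0.
    have : c * a * B * n%:R <= c * a * B * (K%:R * L%:R).
      by rewrite ler_wpM2l// !mulr_ge0.
    by rewrite /b; nra.
  have h4 := le_trans h2 (lerD (lexx _) h3).
  have h5 : 0 <= d * (n%:R - 2 * L%:R).
    by rewrite mulr_ge0 ?(ltW d0)// subr_ge0 -natrM ler_nat.
  by move: h1 h4 h5; rewrite natrD; nra.
Qed.

End tauberian.

(** * Short-time Fourier transforms with Hermite windows *)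

Section hermite_packets.
Variables (R : realType) (h : nat -> R -> R).
Hypothesis hS : hermite_system h.
Local Notation normc := Normc.normc.
Local Notation Re := complex.Re.
Local Notation Im := complex.Im.

Let h0 : forall t, h 0 t = 2 `^ 4^-1 * expR (- (pi * t ^+ 2)).
Proof. by case: hS. Qed.
Let hrec : forall n t, Num.sqrt n.+1%:R * h n.+1 t =
  2 * Num.sqrt pi * t * h n t - Num.sqrt n%:R * h n.-1 t.
Proof. by case: hS. Qed.
Let dh : forall n (t : R), is_derive t 1 (h n) (Num.sqrt pi *
  (Num.sqrt n%:R * h n.-1 t - Num.sqrt n.+1%:R * h n.+1 t)).
Proof. by case: hS. Qed.

(** The test function to which [stft] applies u, with the conjugation omitted since h is real. *)
Definition hermite_packet n (x xi t : R) : R[i] :=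
  (h n (t - x))%:C * expi (- (2 * pi * xi * t)).

Let sq n : R[i] := (Num.sqrt n%:R)%:C.

Lemma hermite_packet_rec n (x xi t : R) :
  sq n.+1 * hermite_packet n.+1 x xi t =
  (2 * Num.sqrt pi)%:C * (t%:C - x%:C) * hermite_packet n x xi t
  - sq n * hermite_packet n.-1 x xi t.
Proof.
rewrite /hermite_packet /sq mulrA -rmorphM /= hrec.
by rewrite rmorphB !rmorphM rmorphB /=; ring.
Qed.

(** At the point s (x0, xi0) the three-term relation multiplies by t - s x0, an affine function of s
    and t, so it stays within the inductive class. *)
Lemma wave_packet_hermite (x0 xi0 : R) n :
  wave_packet x0 xi0 (fun s => hermite_packet n (s * x0) (s * xi0)).
Proof.
have H0 : wave_packet x0 xi0 (fun s => hermite_packet 0 (s * x0) (s * xi0)).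
  rewrite (_ : (fun s => _) =
    fun s t => (2 `^ 4^-1)%:C * moving_gaussian x0 xi0 s t).
    by apply: wave_packet_scale; exact: wave_packet_gaussian.
  apply/funext => s; apply/funext => t.
  by rewrite /hermite_packet h0 /moving_gaussian rmorphM /= -[LHS]mulrA.
have HS m : wave_packet x0 xi0 (fun s => hermite_packet m (s * x0) (s * xi0)) ->
  wave_packet x0 xi0 (fun s => hermite_packet m.-1 (s * x0) (s * xi0)) ->
  wave_packet x0 xi0 (fun s => hermite_packet m.+1 (s * x0) (s * xi0)).
  move=> w1 w2; pose F s t := hermite_packet m (s * x0) (s * xi0) t.
  pose G s t := hermite_packet m.-1 (s * x0) (s * xi0) t.
  pose q : R[i] := (2 * Num.sqrt pi)%:C.
  have s0 : sq m.+1 != 0 by rewrite /sq eq_complex /= eqxx andbT sqrtr_eq0 -ltNge ltr0n.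
  rewrite (_ : (fun s => _) = fun s t => (sq m.+1)^-1 *
     ((0 + - (q * x0%:C) * s%:C + q * t%:C) * F s t + - sq m * G s t)).
    apply: wave_packet_scale; apply: wave_packet_add.
      exact: wave_packet_affine.
    exact: wave_packet_scale.
  apply/funext => s; apply/funext => t; apply: (mulfI s0).
  by rewrite hermite_packet_rec mulVKf// -/q /F /G rmorphM; ring.
suff: wave_packet x0 xi0 (fun s => hermite_packet n (s * x0) (s * xi0)) /\
  wave_packet x0 xi0 (fun s => hermite_packet n.+1 (s * x0) (s * xi0)) by case.
elim: n => [|n [IH0 IH1]]; first by split=> //; exact: HS.
by split => //; exact: HS.
Qed.

Lemma hermite_packet_schwartz n x xi : schwartz (hermite_packet n x xi).
Proof.
have := wave_packet_schwartz 1 (wave_packet_hermite x xi n).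
by rewrite !mul1r.
Qed.

Lemma cder_hermite_packet_t n x xi t : cder (hermite_packet n x xi) t
  ((Num.sqrt pi)%:C * sq n * hermite_packet n.-1 x xi t +
   (- (Num.sqrt pi)%:C * sq n.+1 * hermite_packet n.+1 x xi t +
    - ('i * (2 * pi * xi)%:C) * hermite_packet n x xi t)).
Proof.
apply: cder_eq.
  apply: cderM.
    notypeclasses refine (cder_real _).
    notypeclasses refine (@is_derive_comp_fun _ (h n) (fun s => s - x) t _ _ (dh n (t - x)) _).
    by derive_rules.
  rewrite (_ : (fun t => _) = (fun t => expi (- (2 * pi * xi) * t)));
    last by apply/funext => ?; congr expi; ring.
  exact: cder_expi.
rewrite /hermite_packet /sq.
rewrite (_ : - (2 * pi * xi) * t = - (2 * pi * xi * t)); last by ring.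
set g := h n _; set g1 := h n.-1 _; set g2 := h n.+1 _; set e := expi _.
by apply: eqC; rewrite !(ReM, ImM, ReD, ImD, ReN, ImN) /=; ring.
Qed.

(** The translation contributes -x0 h_n' and the modulation the factor -2 pi i xi0 t. Splitting t as
    (t - s x0) + s x0, the ladder relations turn the first part into neighbours, whose coefficients
    combine into -sqrt(pi) (x0 + i xi0) and minus its conjugate; the second part is the phase
    term. *)
Lemma cder_hermite_packet_s (x0 xi0 s t : R) n :
  let X k := hermite_packet k (s * x0) (s * xi0) t in
  let al : R[i] := (- Num.sqrt pi)%:C * (x0 +i* xi0) in
  cder (fun s => hermite_packet n (s * x0) (s * xi0) t) s
    (al * sq n * X n.-1 + (- al^* * sq n.+1 * X n.+1 +
      'i * (- (2 * pi * s * x0 * xi0))%:C * X n)).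
Proof.
move=> X al; apply: cder_eq.
  apply: cderM.
    notypeclasses refine (cder_real _).
    notypeclasses refine (@is_derive_comp_fun _ (h n) (fun s => t - s * x0)
      s _ _ (dh n (t - s * x0)) _).
    by derive_rules.
  rewrite (_ : (fun s => _) = (fun s => expi (- (2 * pi * xi0 * t) * s)));
    last by apply/funext => ?; congr expi; ring.
  exact: cder_expi.
have e0 : t * (2 * Num.sqrt pi * h n (t - s * x0)) =
  2 * Num.sqrt pi * (s * x0) * h n (t - s * x0) +
    (Num.sqrt n%:R * h n.-1 (t - s * x0) + Num.sqrt n.+1%:R * h n.+1 (t - s * x0)).
  by rewrite hrec; ring.
rewrite /X /al /hermite_packet /sq.
rewrite (_ : - (2 * pi * xi0 * t) * s = - (2 * pi * (s * xi0) * t)); last by ring.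
move: (expi _) (Num.sqrt pi) (sqr_sqrtpi R) e0 => e p <- e0.
move: (h n _) (h n.-1 _) (h n.+1 _) e0 => g g1 g2 e0.
have eI := congr1 ( *%R (p * xi0 * Im e)) e0.
have eR := congr1 ( *%R (p * xi0 * Re e)) e0.
by apply: eqC; rewrite !(ReM, ImM, ReD, ImD, ReN, ImN) /=; [move: eI|move: eR]; clear; lra.
Qed.

(** One use of a ladder relation costs one power of n. The factor 2^e comes from n + 2 <= 2 (n +
    1). *)
Lemma neighbor_bound (A : nat -> R) (C : R) e n : 0 <= C ->
  (forall k, A k <= C * k.+1%:R ^+ e) ->
  Num.sqrt n.+1%:R * A n.+1 <= 2 ^+ e * C * n.+1%:R ^+ e.+1 /\
  Num.sqrt n%:R * A n.-1 <= 2 ^+ e * C * n.+1%:R ^+ e.+1 /\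
  A n <= 2 ^+ e * C * n.+1%:R ^+ e.+1.
Proof.
move=> C0 AC.
have n1 : 1 <= n.+1%:R :> R by rewrite ler1n.
have e2 : 1 <= 2 ^+ e :> R by rewrite exprn_ege1// ler1n.
have sn : Num.sqrt n.+1%:R <= n.+1%:R :> R.
  have : 1 <= Num.sqrt n.+1%:R :> R by rewrite -[leLHS]sqrtr1 ler_sqrt ?ler1n.
  by have := sqrtn_sqr R n.+1; nra.
have sn' : Num.sqrt n%:R <= n.+1%:R :> R.
  by apply: le_trans sn; rewrite ler_sqrt ?ler_nat.
pose M := 2 ^+ e * C * n.+1%:R ^+ e.
have M0 : 0 <= M by rewrite !mulr_ge0 ?exprn_ge0.
have AM k : (k <= n.+1)%N -> A k <= M.
  move=> kn; apply: (le_trans (AC k)); rewrite /M mulrAC [leRHS]mulrC -exprMn ler_wpM2l//.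
  by rewrite lerXn2r ?nnegrE// -natrM ler_nat; move: kn; clear; lia.
have -> : 2 ^+ e * C * n.+1%:R ^+ e.+1 = n.+1%:R * M by rewrite /M exprS; ring.
split; last split.
- apply: (le_trans (ler_wpM2l (sqrtr_ge0 _) (AM _ (leqnn _)))).
  exact: ler_wpM2r.
- apply: (le_trans (ler_wpM2l (sqrtr_ge0 _) (AM _ _))); last exact: ler_wpM2r.
  by rewrite (leq_trans (leq_pred _)).
- by apply: (le_trans (AM _ (leqnSn _))); rewrite ler_peMl.
Qed.

(** Starting from the sup bound [hermite_sup], each factor t is exchanged through the three-term
    relation for the neighbouring packets and a multiple x of the packet itself. *)
Lemma hermite_packet_pow_bound (rho : R) j : 0 <= rho -> exists C e, 0 <= C /\
  forall n x xi t, `|x| <= rho ->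
  `|t| ^+ j * normc (hermite_packet n x xi t) <= C * n.+1%:R ^+ e.
Proof.
move=> rho0; elim: j => [|j [C [e [C0 IH]]]].
  exists (1 + pi * 3), 1; split; first by rewrite addr_ge0 ?mulr_ge0 ?pi_ge0.
  move=> n x xi t _; rewrite mul1r Normc.normcM normc_expi mulr1 normc_real.
  have n1 : 1 <= n.+1%:R :> R by rewrite ler1n.
  have pi0 := pi_ge0 R.
  have b : `|h n (t - x)| ^+ 2 <= ((1 + pi * 3) * n.+1%:R) ^+ 2.
    rewrite real_normK ?num_real//; apply: (le_trans (hermite_sup hS _ _)).
    have b1 : 1 + pi * (2 * n%:R + 1) <= (1 + pi * 3) * n.+1%:R :> R.
      by move: n1 pi0; rewrite -natr1; move: pi => q ? ?; nra.
    apply: (le_trans b1); rewrite expr2 ler_peMr// ?mulr_ge0 ?addr_ge0 ?mulr_ge0//.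
    by move: n1 pi0; move: pi => q ? ?; nra.
  by rewrite expr1 -(ler_pXn2r (n := 2)) ?nnegrE// ?mulr_ge0 ?addr_ge0 ?mulr_ge0.
exists ((2 + rho) * (2 ^+ e * C)), e.+1; split.
  by rewrite !(mulr_ge0, addr_ge0).
move=> n x xi t xr.
pose A k := `|t| ^+ j * normc (hermite_packet k x xi t).
have [h1 [h2 h3]] := @neighbor_bound A C e n C0 (fun k => IH k x xi t xr).
have p1 : 1 <= 2 * Num.sqrt pi :> R.
  rewrite -(ler_pXn2r (n := 2)) ?nnegrE ?mulr_ge0 ?sqrtr_ge0// exprMn (sqr_sqrtpi R).
  by have := pi_ge2 R; lra.
have k : `|t| * normc (hermite_packet n x xi t) <=
   Num.sqrt n.+1%:R * normc (hermite_packet n.+1 x xi t) +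
   Num.sqrt n%:R * normc (hermite_packet n.-1 x xi t) +
   rho * normc (hermite_packet n x xi t).
  have e1 : (2 * Num.sqrt pi)%:C * (t%:C * hermite_packet n x xi t) =
    sq n.+1 * hermite_packet n.+1 x xi t + sq n * hermite_packet n.-1 x xi t +
    (2 * Num.sqrt pi)%:C * (x%:C * hermite_packet n x xi t).
    by rewrite hermite_packet_rec; ring.
  have q0 : 0 < 2 * Num.sqrt pi :> R by rewrite mulr_gt0// sqrtpi_gt0.
  move: (hermite_packet n.+1 x xi t) (hermite_packet n.-1 x xi t)
    (hermite_packet n x xi t) e1 => a b c e1.
  have := congr1 (fun z : R[i] => normc z) e1.
  rewrite Normc.normcM Normc.normcM normc_real normc_real (gtr0_norm q0) => e2.
  have le2 : 2 * Num.sqrt pi * (`|t| * normc c) <=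
    Num.sqrt n.+1%:R * normc a + Num.sqrt n%:R * normc b +
    2 * Num.sqrt pi * (`|x| * normc c).
    rewrite e2; apply: (le_trans (le_normcD _ _)); apply: lerD.
      apply: (le_trans (le_normcD _ _)).
      by rewrite !Normc.normcM !normc_real !ger0_norm ?sqrtr_ge0.
    by rewrite !Normc.normcM !normc_real (gtr0_norm q0).
  have := ler_wpM2r (normc_ge0 c) xr.
  have : 0 <= Num.sqrt n.+1%:R * normc a by rewrite mulr_ge0 ?sqrtr_ge0 ?normc_ge0.
  have : 0 <= Num.sqrt n%:R * normc b by rewrite mulr_ge0 ?sqrtr_ge0 ?normc_ge0.
  have : 0 <= `|x| * normc c by rewrite mulr_ge0 ?normc_ge0.
  move: le2 p1; clear; move: (Num.sqrt _) (Num.sqrt _) (Num.sqrt _) => p sa sb.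
  move: (normc a) (normc b) (normc c) => na nb nc; nra.
rewrite exprSr -mulrA.
apply: le_trans (ler_wpM2l (exprn_ge0 j (normr_ge0 t)) k) _.
have -> : `|t| ^+ j * (Num.sqrt n.+1%:R * normc (hermite_packet n.+1 x xi t) +
   Num.sqrt n%:R * normc (hermite_packet n.-1 x xi t) +
   rho * normc (hermite_packet n x xi t)) = Num.sqrt n.+1%:R * A n.+1 +
   Num.sqrt n%:R * A n.-1 + rho * A n by rewrite /A; ring.
have := ler_wpM2l rho0 h3.
by move: h1 h2; clear; lra.
Qed.

(** The t-derivative is a combination of the packets n-1, n+1 and n with coefficients O(sqrt(n+1)),
    uniformly for |xi| <= rho; induction on k. *)
Lemma hermite_packet_seminorm_bound (rho : R) k : 0 <= rho -> forall j, exists C e,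
  0 <= C /\ forall n x xi t, `|x| <= rho -> `|xi| <= rho ->
  `|t| ^+ j * normc (cderive1n k (hermite_packet n x xi) t) <= C * n.+1%:R ^+ e.
Proof.
move=> rho0; elim: k => [|k IH] j.
  have [C [e [C0 H]]] := hermite_packet_pow_bound j rho0; exists C, e; split => //.
  by move=> n x xi t xr _; rewrite cderive1n0; exact: H.
have [C [e [C0 H]]] := IH j; have p0 := ltW (sqrtpi_gt0 R).
exists ((2 * Num.sqrt pi + 2 * pi * rho) * (2 ^+ e * C)), e.+1; split.
  by apply: mulr_ge0; [apply: addr_ge0; rewrite !mulr_ge0 ?pi_ge0|rewrite mulr_ge0 ?exprn_ge0].
move=> n x xi t xr xir.
pose A m := `|t| ^+ j * normc (cderive1n k (hermite_packet m x xi) t).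
have [h1 [h2 h3]] := @neighbor_bound A C e n C0 (fun m => H m x xi t xr xir).
have sm m := (hermite_packet_schwartz m x xi).1.
pose c1 := (Num.sqrt pi)%:C * sq n.
pose c2 := - (Num.sqrt pi)%:C * sq n.+1.
pose c3 : R[i] := - ('i * (2 * pi * xi)%:C).
have s3 : csmooth (fun t => c3 * hermite_packet n x xi t + 0).
  by apply: (csmooth_lin c3 (sm n) (schwartz0 R).1).1.
have [s2 e2] := csmooth_lin c2 (sm n.+1) s3.
have [_ e1] := csmooth_lin c1 (sm n.-1) s2.
have [_ e3] := csmooth_lin c3 (sm n) (schwartz0 R).1.
rewrite (cderive1nSr (f' := fun t => c1 * hermite_packet n.-1 x xi t +
  (c2 * hermite_packet n.+1 x xi t + (c3 * hermite_packet n x xi t + 0)))); last first.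
  by move=> t'; apply: cder_eq (cder_hermite_packet_t n x xi t') _; rewrite addr0.
rewrite e1 e2 e3.
rewrite cderive1n_cst0 addr0.
have -> : (2 * Num.sqrt pi + 2 * pi * rho) * (2 ^+ e * C) * n.+1%:R ^+ e.+1 =
  Num.sqrt pi * (2 ^+ e * C * n.+1%:R ^+ e.+1) +
  (Num.sqrt pi * (2 ^+ e * C * n.+1%:R ^+ e.+1) +
   2 * pi * rho * (2 ^+ e * C * n.+1%:R ^+ e.+1)) by ring.
have scal (a : R[i]) b B : `|t| ^+ j * normc b <= B -> `|t| ^+ j * normc (a * b) <= normc a * B.
  by move=> bB; rewrite Normc.normcM mulrCA ler_wpM2l ?normc_ge0.
have nsq m : normc (sq m) = Num.sqrt m%:R.
  by rewrite normc_real ger0_norm ?sqrtr_ge0.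
have nc1 : normc c1 = Num.sqrt pi * Num.sqrt n%:R.
  by rewrite /c1 Normc.normcM nsq normc_real ger0_norm.
have nc2 : normc c2 = Num.sqrt pi * Num.sqrt n.+1%:R.
  by rewrite /c2 Normc.normcM nsq normcN normc_real ger0_norm.
apply: le_normcM_pow; last apply: le_normcM_pow.
- apply: le_trans (scal _ _ _ (lexx _)) _; rewrite nc1 -[leLHS]mulrA.
  exact: (ler_wpM2l p0 h2).
- apply: le_trans (scal _ _ _ (lexx _)) _; rewrite nc2 -[leLHS]mulrA.
  exact: (ler_wpM2l p0 h1).
- apply: le_trans (scal _ _ _ h3) _.
  apply: ler_wpM2r; first by rewrite !mulr_ge0 ?exprn_ge0.
  rewrite /c3 normcN Normc.normcM normc_real normrM ger0_norm ?mulr_ge0 ?pi_ge0//.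
  rewrite (_ : normc 'i = 1); last by rewrite /= expr0n expr1n add0r sqrtr1.
  by rewrite mul1r ler_wpM2l ?mulr_ge0 ?pi_ge0.
Qed.

Lemma stft_growth (u : tempered_distribution R) (rho : R) : 0 <= rho ->
  exists (C : R) e, forall n x xi, `|x| <= rho -> `|xi| <= rho ->
  normc (u (hermite_packet n x xi)) <= C * n.+1%:R ^+ e.
Proof.
move=> rho0; have [m [D [D0 HD]]] := pairing_bound u.
(* One real y encodes both the constant and, truncated, the exponent, so that [uniform_bound]
   applies. *)
pose p j k (y : R) := 0 <= y /\ forall n x xi t, `|x| <= rho -> `|xi| <= rho ->
  `|t| ^+ j * normc (cderive1n k (hermite_packet n x xi) t) <=
    y * n.+1%:R ^+ Num.truncn y.
have [||B B0 HB] := @uniform_bound R p m.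
- move=> j k y y' yy' [y0 H]; split; first exact: le_trans yy'.
  move=> n x xi t xr xir; apply: (le_trans (H n x xi t xr xir)).
  apply: ler_pM; rewrite ?exprn_ge0//.
  by rewrite ler_weXn2l ?ler1n//; exact: le_truncn.
- move=> j k; have [C [e [C0 H]]] := hermite_packet_seminorm_bound k rho0 j.
  exists (C + e%:R); split; first by rewrite addr_ge0.
  move=> n x xi t xr xir; apply: (le_trans (H n x xi t xr xir)).
  apply: ler_pM; rewrite ?exprn_ge0// ?lerDl//.
  by rewrite ler_weXn2l ?ler1n// truncn_ge_nat ?addr_ge0// lerDr.
exists (D * B), (Num.truncn B) => n x xi xr xir; rewrite -mulrA; apply: HD.
- exact: hermite_packet_schwartz.
- by rewrite mulr_gt0// exprn_gt0.
- by move=> j k t jm km; have [_] := HB j k jm km; apply.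
Qed.

End hermite_packets.

(** * The energy identity and its consequence for spectrogram averages *)

Section spectrogram_average.
Variables (R : realType) (h : nat -> R -> R).
Hypothesis hS : hermite_system h.
Local Notation normc := Normc.normc.
Local Notation Re := complex.Re.
Local Notation Im := complex.Im.
Local Notation hermite_packet := (hermite_packet h).
Variable u : tempered_distribution R.

Let sq n : R[i] := (Num.sqrt n%:R)%:C.

Definition stft_energy (x0 xi0 : R) n (s : R) : R :=
  normc (u (hermite_packet n (s * x0) (s * xi0))) ^+ 2.

Section path.
Variables x0 xi0 : R.
Let al : R[i] := (- Num.sqrt pi)%:C * (x0 +i* xi0).
Let X n s := u (hermite_packet n (s * x0) (s * xi0)).

Let cderX n s : cder (X n) s (al * sq n * X n.-1 s + (- al^* * sq n.+1 * X n.+1 s +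
      'i * (- (2 * pi * s * x0 * xi0))%:C * X n s)).
Proof.
pose F m s := hermite_packet m (s * x0) (s * xi0).
(* The phase coefficient is linear in s, so the affine constructor makes [Fs] a wave packet. *)
pose b : R[i] := 'i * (- (2 * pi * x0 * xi0))%:C.
pose Fs s t := al * sq n * F n.-1 s t + (- al^* * sq n.+1 * F n.+1 s t +
      (0 + b * s%:C + 0 * t%:C) * F n s t).
have wF m : wave_packet x0 xi0 (F m) := wave_packet_hermite hS x0 xi0 m.
have wFs : wave_packet x0 xi0 Fs.
  apply: wave_packet_add; first exact: wave_packet_scale.
  by apply: wave_packet_add; [exact: wave_packet_scale|exact: wave_packet_affine].
have bs z : 'i * (- (2 * pi * z * x0 * xi0))%:C = 0 + b * z%:C + 0 :> R[i].
  by apply: eqC; rewrite /b !(ReD, ReM, ImD, ImM) /=; ring.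
have dF z t : cder (F n ^~ t) z (Fs z t).
  by apply: cder_eq (cder_hermite_packet_s hS x0 xi0 z t n) _; rewrite /Fs mul0r -bs.
refine (cder_eq (cder_pairing u s (wF n) wFs dF) _).
have sF m := hermite_packet_schwartz hS m (s * x0) (s * xi0).
have -> : Fs s = fun t => al * sq n * F n.-1 s t + (- al^* * sq n.+1 * F n.+1 s t +
      'i * (- (2 * pi * s * x0 * xi0))%:C * F n s t).
  by apply/funext => t; rewrite /Fs mul0r -bs.
have s3 := schwartz_scale ('i * (- (2 * pi * s * x0 * xi0))%:C) (sF n).
have s2 := schwartz_lin (- al^* * sq n.+1) (sF n.+1) s3.
by rewrite (pairing_linear u _ (sF n.-1) s2) (pairing_linear u _ (sF n.+1) s3) pairing_scale.
Qed.

(* The flow of energy from level [n.-1] to level [n]. *)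
Let A n s := 2 * Num.sqrt n%:R *
  (Re (al * X n.-1 s) * Re (X n s) + Im (al * X n.-1 s) * Im (X n s)).

(** The phase term is an imaginary multiple of [X n] and leaves the modulus unchanged. Since the
    raising coefficient is minus the conjugate of the lowering one, what leaves level n is what
    enters level n+1. *)
Let is_derive_energy n (s : R) :
  is_derive s 1 (stft_energy x0 xi0 n) (A n s - A n.+1 s).
Proof.
rewrite (_ : stft_energy x0 xi0 n = fun s => Re (X n s) ^+ 2 + Im (X n s) ^+ 2); last first.
  by apply/funext => z; rewrite /stft_energy normcE2.
have [d1 d2] := cderX n s; derive.
rewrite /A -[n.+1.-1]/n !expr1.
move: (X n s) (X n.-1 s) (X n.+1 s) {d1 d2} => a b c.
move: al => q; rewrite !(ReM, ImM, ReD, ImD, ReN, ImN).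
have ReJ (z : R[i]) : Re z^* = Re z by case: z.
have ImJ (z : R[i]) : Im z^* = - Im z by case: z.
by rewrite ReJ ImJ /sq /=; ring.
Qed.

Lemma is_derive_energy_sum n (s : R) :
  is_derive s 1 (fun s => \sum_(k < n) stft_energy x0 xi0 k s) (- A n s).
Proof.
rewrite (_ : (fun s : R => _) = \sum_(k < n) stft_energy x0 xi0 k); last first.
  by apply/funext => z; rewrite fct_sumE.
rewrite (_ : - A n s = \sum_(k < n) (A k s - A k.+1 s)).
  by apply: is_derive_sum => k; exact: is_derive_energy.
(* Nothing flows in from below: A 0 carries the factor sqrt 0. *)
elim: n => [|n IH]; first by rewrite big_ord0 /A sqrtr0 mulr0 mul0r oppr0.
by rewrite big_ord_recr/= -IH; ring.
Qed.

Lemma energy_sum_derivative_bound n s (rho : R) : `|x0| <= rho -> `|xi0| <= rho ->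
  `|- A n s| <= 4 * rho * Num.sqrt n%:R *
    (stft_energy x0 xi0 n.-1 s + stft_energy x0 xi0 n s).
Proof.
move=> xr xir; rewrite /stft_energy -/(X n.-1 s) -/(X n s).
(* sqrt(pi) <= 2 and |x0| + |xi0| <= 2 rho. *)
have alr : normc al <= 4 * rho.
  rewrite /al Normc.normcM normc_real normrN ger0_norm ?sqrtr_ge0//.
  have sp : Num.sqrt pi <= 2 :> R.
    rewrite -(ler_pXn2r (n := 2)) ?nnegrE ?sqrtr_ge0// (sqr_sqrtpi R).
    by have := pihalf_lt2 R; move: pi => q; lra.
  rewrite (_ : 4 * rho = 2 * (rho + rho)); last by ring.
  apply: ler_pM; rewrite ?sqrtr_ge0 ?normc_ge0//.
  by apply: (le_trans (normc_le _)); exact: lerD.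
rewrite normrN /A -mulrA normrM (ger0_norm (x := 2))// normrM ger0_norm ?sqrtr_ge0//.
rewrite [leRHS]mulrAC [leRHS]mulrC mulrCA; apply: ler_wpM2l; first exact: sqrtr_ge0.
set a := X n.-1 s; set b := X n s.
have c1 : `|Re (al * a) * Re b + Im (al * a) * Im b| <= normc (al * a) * normc b.
  rewrite -(ler_pXn2r (n := 2)) ?nnegrE ?mulr_ge0 ?normc_ge0// exprMn !normcE2.
  rewrite real_normK ?num_real//.
  move: (Re (al * a)) (Im (al * a)) (Re b) (Im b) => p q r t.
  by have := sqr_ge0 (p * t - q * r); nra.
apply: (@le_trans _ _ (2 * (normc al * (normc a * normc b)))).
  by rewrite ler_wpM2l// mulrA -Normc.normcM.
have := normc_ge0 a; have := normc_ge0 b; have := normc_ge0 al; move: alr.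
move: (normc al) (normc a) (normc b) => x y z xr' x0' y0 z0.
have : 0 <= x * (y - z) ^+ 2 by rewrite mulr_ge0 ?sqr_ge0.
have : 0 <= (4 * rho - x) * (y ^+ 2 + z ^+ 2).
  by rewrite mulr_ge0 ?subr_ge0// addr_ge0 ?sqr_ge0.
by nra.
Qed.

End path.

Lemma stft_energy_average_uniform (rho : R) : 0 <= rho ->
  (forall eta, 0 < eta -> exists N, forall n, (N <= n)%N ->
    `|\sum_(k < n) normc (u (hermite_packet k 0 0)) ^+ 2 - n%:R| <= eta * n%:R) ->
  forall eps, 0 < eps -> exists N, forall n x xi, (N <= n)%N ->
    `|x| <= rho -> `|xi| <= rho ->
    `|\sum_(k < n) normc (u (hermite_packet k x xi)) ^+ 2 - n%:R| <= eps * n%:R.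
Proof.
move=> rho0 H0 eps eps0.
have [C [e HC]] := stft_growth hS u rho0.
(* Each point of the square is itself taken as a direction and is reached at s = 1. *)
pose I := {z : R * R | `|z.1| <= rho /\ `|z.2| <= rho}.
have xC (i : I) k s : 0 <= s <= 1 ->
    stft_energy (sval i).1 (sval i).2 k s <= C ^+ 2 * k.+1%:R ^+ (2 * e).
  move=> /andP[s0 s1]; case: i => -[x xi] [xr xir] /=.
  have sr z : `|z| <= rho -> `|s * z| <= rho.
    move=> zr; rewrite normrM (ger0_norm s0); apply: le_trans zr.
    by rewrite ler_piMl.
  rewrite mulnC exprM -exprMn lerXn2r ?nnegrE ?normc_ge0//.
    by apply: le_trans (HC k 0 0 _ _); rewrite ?normc_ge0 ?normr0.
  by apply: HC; exact: sr.
have x0 (i : I) k : stft_energy (sval i).1 (sval i).2 k 0 =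
    normc (u (hermite_packet k 0 0)) ^+ 2 by rewrite /stft_energy !mul0r.
have [N HN] := uniform_average (fun i k s => sqr_ge0 _)
  (fun (i : I) n s => is_derive_energy_sum (sval i).1 (sval i).2 n s)
  (mulr_ge0 (ler0n _ 4) rho0)
  (fun (i : I) n s _ => energy_sum_derivative_bound n s (svalP i).1 (svalP i).2)
  xC x0 (fun k => sqr_ge0 _) H0 eps0.
exists N => n x xi nN xr xir.
have := HN n (exist _ (x, xi) (conj xr xir)) 1 nN; rewrite ler01 lexx => /(_ isT).
rewrite (eq_bigr (fun k : 'I_n => normc (u (hermite_packet k x xi)) ^+ 2))//.
by move=> k _; rewrite /stft_energy /= !mul1r.
Qed.

End spectrogram_average.

(** * Averages of squares of Gaussian variables *)

Section almost_sure.
Context d (T : measurableType d) (R : realType) (P : probability T R).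

Lemma bounded_partial_sums_cvg0 (v : nat -> R) (C : R) : (forall j, 0 <= v j) ->
  (forall n, \sum_(j < n) v j <= C) ->
  forall eta, 0 < eta -> exists J, forall j, (J <= j)%N -> v j <= eta.
Proof.
move=> v0 vC eta eta0.
have cv : cvgn (series v).
  apply: nondecreasing_is_cvgn.
    by apply/nondecreasing_seqP => n; rewrite /series/= big_nat_recr//= lerDl.
  exists C => _ [n _ <-]; rewrite /series/= big_mkord; exact: vC.
have /cvgrPdist_le/(_ _ eta0)[J _ HJ] := cvg_series_cvg_0 cv.
exists J => j Jj; have := HJ j Jj; rewrite sub0r normrN.
by apply: le_trans; exact: ler_norm.
Qed.

(** By monotone convergence the sum of the [V j] has finite expectation, so it is finite almost
    everywhere and its terms tend to 0. *)
Lemma summable_ae_cvg0 (V : nat -> T -> R) (a : nat -> R) (C : R) :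
  (forall j w, 0 <= V j w) -> (forall j, has_integral P (V j) (a j)) ->
  (forall n, \sum_(j < n) a j <= C) ->
  {ae P, forall w, forall eta, 0 < eta ->
     exists J, forall j, (J <= j)%N -> V j w <= eta}.
Proof.
move=> V0 HV aC.
pose F w := (\sum_(j <oo) (V j w)%:E)%E.
have mV j : measurable_fun setT (fun w => (V j w)%:E) := measurable_int _ (HV j).1.
have V0' j w : (0 <= (V j w)%:E)%E by rewrite lee_fin.
have IF : (\int[P]_w F w <= C%:E)%E.
  rewrite /F integral_nneseries//.
  apply: lime_le; first by apply: is_cvg_nneseries => j _ _; exact: integral_ge0.
  apply: nearW => n; rewrite (eq_bigr (fun j => (a j)%:E)).
    by rewrite sumEFin lee_fin big_mkord.
  by move=> j _; exact: (HV j).2.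
have F0 w : (0 <= F w)%E by apply: nneseries_ge0.
have mF : measurable_fun setT F by exact: ge0_emeasurable_sum.
have iF : P.-integrable setT F.
  apply/integrableP; split => //.
  under eq_integral do rewrite gee0_abs//.
  by apply: le_lt_trans IF _; rewrite ltry.
have := integrable_ae measurableT iF; apply: filterS => w /(_ Logic.I) Fw.
apply: (@bounded_partial_sums_cvg0 (V ^~ w) (fine (F w))) => // n.
rewrite -lee_fin fineK// -sumEFin -(big_mkord xpredT (fun j => (V j w)%:E)).
exact: nneseries_lim_ge.
Qed.

End almost_sure.

Section subsequence.
Variable R : realType.

(** A monotone sequence is squeezed between its values at consecutive sixth powers, whose ratio
    tends to 1. *)
Lemma sixth_power_interpolation (S : nat -> R) (c : R) : 0 <= c <= 1 ->
  {homo S : m n / (m <= n)%N >-> m <= n} ->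
  (forall eta, 0 < eta -> exists J, forall j, (J <= j)%N ->
     `|S (j.+1 ^ 6)%N - c * (j.+1 ^ 6)%:R| <= eta * (j.+1 ^ 6)%:R) ->
  forall eta, 0 < eta -> exists N, forall n, (N <= n)%N ->
     `|S n - c * n%:R| <= eta * n%:R.
Proof.
move=> /andP[c0 c1] Smono HS eta eta0.
pose e : R := Num.min (eta / 4) 4^-1.
have e0 : 0 < e by rewrite lt_min divr_gt0//= invr_gt0.
have e4 : 4 * e <= eta.
  have : e <= eta / 4; [by rewrite ge_min lexx|lra].
have e1 : 4 * e <= 1.
  have : e <= 4^-1; [by rewrite ge_min lexx orbT|lra].
have [J HJ] := HS e e0.
(* 63 = 2^6 - 1: for y >= 1, (y+1)^6 <= y^6 + 63 y^5, which is at most (1 + e) y^6 when e y >=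
   63. *)
have [K HK] : exists K : nat, 63 / e <= K%:R.
  exists (Num.truncn (63 / e)).+1.
  by rewrite ltW// real_truncnS_gt// num_real.
exists ((J + K).+1 ^ 6)%N => n nN.
have [j [jJ jK jn nj]] : exists j, [/\ J <= j, K <= j, j.+1 ^ 6 <= n & n <= j.+2 ^ 6]%N.
  have ex : exists j, ((J + K <= j) && (j.+1 ^ 6 <= n))%N.
    by exists (J + K)%N; rewrite leqnn.
  have ub j : ((J + K <= j) && (j.+1 ^ 6 <= n))%N -> (j <= n)%N.
    move=> /andP[_]; apply: leq_trans.
    by rewrite (leq_trans (leqnSn _))// -{1}(expn1 j.+1) leq_pexp2l.
  case: (ex_maxnP ex ub) => j /andP[jJK jn] jmax; exists j; split => //.
  - exact: leq_trans (leq_addr _ _) jJK.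
  - exact: leq_trans (leq_addl _ _) jJK.
  - rewrite leqNgt; apply/negP => nj.
    by have := jmax j.+1; rewrite (ltnW nj) (leqW jJK) ltnn => /(_ isT).
have := HJ _ jJ; have := HJ _ (leqW jJ).
have := Smono _ _ jn; have := Smono _ _ nj.
move: jn nj; rewrite -!(ler_nat R).
set A := (j.+1 ^ 6)%:R : R; set B := (j.+2 ^ 6)%:R : R; set x := n%:R : R.
move=> Ax xB SB SA HB HA.
have BA : B <= (1 + e) * A.
  have jx : 63 <= e * j.+1%:R.
    rewrite mulrC -ler_pdivrMr//; apply: (le_trans HK).
    by rewrite ler_nat (leq_trans jK).
  rewrite /A /B !natrX -[j.+2%:R]natr1.
  have : 1 <= j.+1%:R :> R by rewrite ler1n.
  move: (j.+1%:R) jx => y yx y1.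
  have : (y + 1) ^+ 6 <= y ^+ 6 + 63 * y ^+ 5.
    have h k : y ^+ k <= y ^+ k.+1 by rewrite exprS ler_peMl// exprn_ge0// (le_trans _ y1).
    have h0 := h 0; have h1 := h 1; have h2 := h 2; have h3 := h 3; have h4 := h 4.
    rewrite [leLHS](_ : _ = y ^+ 6 + 6 * y ^+ 5 + 15 * y ^+ 4 + 20 * y ^+ 3 +
      15 * y ^+ 2 + 6 * y ^+ 1 + y ^+ 0); last by rewrite expr0 expr1; ring.
    by move: h0 h1 h2 h3 h4; clear; lra.
  move=> /le_trans; apply; rewrite [leRHS]mulrDl mul1r lerD2l [in leRHS]exprS mulrA.
  by rewrite ler_wpM2r// exprn_ge0// (le_trans _ y1).
have A0 : 0 <= A by [].
move: HA HB; rewrite !ler_norml => /andP[HA _] /andP[_ HB].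
apply/andP; split; nra.
Qed.

End subsequence.

(** * A strong law for squares from pairwise cosine moments *)

Section square_averages.
Context d (T : measurableType d) (R : realType) (P : probability T R).

Lemma norm_sin_le (x : R) : `|sin x| <= `|x|.
Proof.
have := @MVT_bound R sin cos 0 x 1 (fun y => is_derive_sin y) _.
by rewrite sin0 !subr0 mul1r; apply => y _; rewrite ler_norml cos_geN1 cos_le1.
Qed.

Definition sinc2 (t y : R) : R := (sin (t * y) / t) ^+ 2.

Lemma sinc2E (t y : R) : t != 0 -> sinc2 t y = (1 - cos (2 * t * y)) / (2 * t ^+ 2).
Proof.
move=> t0; rewrite (_ : 2 * t * y = t * y + t * y); last by ring.
rewrite cosD -!expr2 (_ : 1 - _ = 2 * sin (t * y) ^+ 2).
  by rewrite /sinc2; field.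
by have := cos2Dsin2 (t * y); lra.
Qed.

Lemma sinc2_ge0 (t y : R) : 0 <= sinc2 t y. Proof. exact: sqr_ge0. Qed.

Lemma sinc2_le (t y : R) : t != 0 -> sinc2 t y <= y ^+ 2.
Proof.
move=> t0; rewrite /sinc2 -(real_normK (num_real (sin _ / t))) -(real_normK (num_real y)).
rewrite lerXn2r ?nnegrE// normrM normfV ler_pdivrMr ?normr_gt0//.
by rewrite -normrM mulrC norm_sin_le.
Qed.

Lemma sinc2_cvg (y : R) : sinc2 n.+1%:R^-1 y @[n --> \oo] --> y ^+ 2.
Proof.
have dsin : is_derive (0 : R) 1 (fun t : R => sin (t * y)) y.
  by derive => /=; rewrite !mul0r cos0; ring.
have : t^-1 * sin (t * y) @[t --> 0^'] --> y.
  have [/cvg_ex[l lP] E] := dsin; rewrite -[X in _ --> X]E {E}.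
  rewrite (_ : (fun t : R => t^-1 * sin (t * y)) =
     (fun t => t^-1 *: (sin ((t *: 1 + 0) * y) - sin (0 * y)))); last first.
    by apply/funext => t; rewrite mul0r sin0 subr0 addr0 /GRing.scale/= mulr1.
  by rewrite /derive (cvg_lim _ lP).
move=> /cvgr_dnbhsP/(_ (fun n => n.+1%:R^-1)) H; rewrite /sinc2.
apply: (@cvgM _ _ _ _ (fun n => sin (n.+1%:R^-1 * y) / n.+1%:R^-1)
  (fun n => sin (n.+1%:R^-1 * y) / n.+1%:R^-1));
  under eq_fun do rewrite mulrC; apply: H; split;
  by [move=> n; rewrite invr_eq0 pnatr_eq0|exact: cvg_harmonic].
Qed.

Lemma integrable_bounded (f : T -> R) (C : R) : measurable_fun setT f ->
  (forall w, `|f w| <= C) -> P.-integrable setT (EFin \o f).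
Proof.
move=> mf fC; apply: measurable_bounded_integrable => //.
  by rewrite (le_lt_trans (probability_le1 P measurableT))// ltry.
by exists C; split; [exact: num_real|move=> x Cx y _; exact: le_trans (fC y) (ltW Cx)].
Qed.

Lemma one_sub_expRN (x : R) : 0 <= x -> x - x ^+ 2 <= 1 - expR (- x) <= x.
Proof.
move=> x0; have h1 := expR_ge1Dx (- x); have h2 := expR_ge1Dx x.
rewrite expRN in h1 *; have e0 := expR_gt0 x.
have pq : expR x * (expR x)^-1 = 1 by rewrite divff// gt_eqF.
have q0 : 0 < (expR x)^-1 by rewrite invr_gt0.
move: (expR x)^-1 h1 pq q0 => q h1 pq q0.
have : q * (1 + x) <= q * expR x by rewrite ler_wpM2l// ltW.
by rewrite [q * expR x]mulrC pq => h3; apply/andP; split; nra.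
Qed.

Variable Y : nat -> T -> R.
Hypothesis mY : forall k, measurable_fun setT (Y k).
Hypothesis hcos : forall k (a : R),
  (\int[P]_w (cos (a * Y k w))%:E = (expR (- (a ^+ 2 / 4)))%:E)%E.
Hypothesis hcosD : forall k l (a : R), k != l ->
  (\int[P]_w (cos (a * (Y k w + Y l w)))%:E = (expR (- (a ^+ 2 / 2)))%:E)%E.
Hypothesis hcosB : forall k l (a : R), k != l ->
  (\int[P]_w (cos (a * (Y k w - Y l w)))%:E = (expR (- (a ^+ 2 / 2)))%:E)%E.

Let mcos (f : T -> R) : measurable_fun setT f -> measurable_fun setT (fun w => cos (f w)).
Proof.
by move=> mf; apply: measurableT_comp => //; apply: continuous_measurable_fun;
  exact: continuous_cos.
Qed.

Let Icos (f : T -> R) v : measurable_fun setT f ->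
  (\int[P]_w (cos (f w))%:E = v%:E)%E -> has_integral P (fun w => cos (f w)) v.
Proof.
move=> mf fv; split => //; apply: (integrable_bounded (C := 1)); first exact: mcos.
by move=> w; rewrite ler_norml cos_geN1 cos_le1.
Qed.

Let has_integral1 : has_integral P (fun=> 1) 1.
Proof.
split; first by apply: (integrable_bounded (C := 1)) => // w; rewrite normr1.
by rewrite integral_cst// mul1e; exact: probability_setT.
Qed.

Let has_integral_eq (f g : T -> R) v w : has_integral P f v -> f = g -> v = w ->
  has_integral P g w.
Proof. by move=> + <- <-. Qed.

(* The mean of [sinc2 t Y] for [Y] centred Gaussian of variance 1/2. *)
Definition sinc2_mean (t : R) : R := (1 - expR (- t ^+ 2)) / (2 * t ^+ 2).

Lemma has_integral_sinc2 k (t : R) : t != 0 ->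
  has_integral P (fun w => sinc2 t (Y k w)) (sinc2_mean t).
Proof.
move=> t0.
have I1 : has_integral P (fun w => cos (2 * t * Y k w)) (expR (- t ^+ 2)).
  apply: Icos; first exact: measurable_funM.
  by rewrite hcos; congr (expR (- _))%:E; field.
apply: has_integral_eq (has_integralZ (2 * t ^+ 2)^-1
  (has_integralD has_integral1 (has_integralZ (-1) I1))) _ _.
  by apply/funext => w; rewrite sinc2E// mulN1r mulrC.
by rewrite /sinc2_mean mulN1r mulrC.
Qed.

Lemma sinc2_mean_bounds (t : R) : t != 0 -> 2^-1 - t ^+ 2 / 2 <= sinc2_mean t <= 2^-1.
Proof.
move=> t0; have t2 : 0 < t ^+ 2 by rewrite exprn_even_gt0.
have /andP[h1 h2] := one_sub_expRN (ltW t2).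
have t4 : 0 < 2 * t ^+ 2 by lra.
rewrite /sinc2_mean ler_pdivlMr// ler_pdivrMr//.
by apply/andP; split; lra.
Qed.

(** Fatou's lemma as t = 1/(n+1) tends to 0. An upper bound on the second moment is enough, since
    y^2 - [sinc2 t y] is nonnegative. *)
Lemma has_integral_sqr k : exists2 v : R, v <= 2^-1 &
  has_integral P (fun w => Y k w ^+ 2) v.
Proof.
pose f n w := (sinc2 n.+1%:R^-1 (Y k w))%:E.
have tn n : n.+1%:R^-1 != 0 :> R by rewrite invr_eq0 pnatr_eq0.
have If n := has_integral_sinc2 k (tn n).
have mf n : measurable_fun setT (f n) by exact: measurable_int (If n).1.
have f0 n w : setT w -> (0 <= f n w)%E by rewrite lee_fin sinc2_ge0.
have := fatou P measurableT mf f0.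
have -> : (fun w => limn_einf (f^~ w)) = (fun w => (Y k w ^+ 2)%:E).
  apply/funext => w; apply: (cvg_limn_einf_sup _).1.
  by apply/cvg_EFin; [exact: nearW|exact: sinc2_cvg].
have lim2 : (limn_einf (fun n => \int[P]_w f n w) <= (2^-1)%:E)%E.
  rewrite limn_einf_lim; apply: lime_le; first exact: is_cvg_einfs.
  apply: nearW => n; apply: (@le_trans _ _ (\int[P]_w f n w)%E).
    by apply: ereal_inf_lbound; exists n => //=.
  by rewrite (If n).2 lee_fin; case/andP: (sinc2_mean_bounds (tn n)).
move=> /le_trans/(_ lim2) le2.
have mY2 : measurable_fun setT (fun w => (Y k w ^+ 2)%:E).
  by apply/measurable_EFinP; exact: measurable_funX.
have pos w : (0 <= (Y k w ^+ 2)%:E)%E by rewrite lee_fin sqr_ge0.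
have IY : P.-integrable setT (fun w => (Y k w ^+ 2)%:E).
  apply/integrableP; split => //; under eq_integral do rewrite gee0_abs//.
  by apply: le_lt_trans le2 _; rewrite ltry.
have fn := integrable_fin_num measurableT IY.
exists (fine (\int[P]_w (Y k w ^+ 2)%:E)%E); first by rewrite -lee_fin fineK.
by split => //; rewrite fineK.
Qed.

Let has_integral_cst (a : R) : has_integral P (fun=> a) a.
Proof.
by apply: has_integral_eq (has_integralZ a has_integral1) _ _;
  [apply/funext => w|]; rewrite mulr1.
Qed.

(** The product of two cosines is half the sum of the cosines of the sum and of the difference, and
    both have mean q^2. *)
Lemma has_integral_centered_mul k l (t : R) : k != l ->
  let e i w := expR (- t ^+ 2) - cos (2 * t * Y i w) in
  has_integral P (fun w => e k w * e l w) 0.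
Proof.
move=> kl e; set q := expR (- t ^+ 2).
have Ic i : has_integral P (fun w => cos (2 * t * Y i w)) q.
  apply: Icos; first exact: measurable_funM.
  by rewrite hcos /q; congr (expR (- _))%:E; field.
have q2 : expR (- ((2 * t) ^+ 2 / 2)) = q ^+ 2.
  by rewrite /q [RHS]expr2 -expRD; congr expR; field.
have ID : has_integral P (fun w => cos (2 * t * (Y k w + Y l w))) (q ^+ 2).
  apply: Icos; last by rewrite hcosD// q2.
  by apply: measurable_funM => //; exact: measurable_funD.
have IB : has_integral P (fun w => cos (2 * t * (Y k w - Y l w))) (q ^+ 2).
  apply: Icos; last by rewrite hcosB// q2.
  by apply: measurable_funM => //; exact: measurable_funB.
apply: has_integral_eq (has_integralD (has_integral_cst (q ^+ 2))
  (has_integralD (has_integralD (has_integralZ (- q) (Ic k)) (has_integralZ (- q) (Ic l)))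
    (has_integralZ 2^-1 (has_integralD ID IB)))) _ _.
  apply/funext => w; rewrite /e -/q !mulrDr mulrN cosD cosB.
  by field.
by field.
Qed.

(** Each summand is (q - cos) / (2 t^2). Off-diagonal products have mean 0 and each of the M
    diagonal ones contributes at most 4 / (4 t^4). *)
Lemma has_integral_centered_sum M (t : R) : t != 0 -> exists2 v : R, v <= M%:R / t ^+ 4 &
  has_integral P (fun w => (\sum_(k < M) (sinc2 t (Y k w) - sinc2_mean t)) ^+ 2) v.
Proof.
move=> t0; pose q := expR (- t ^+ 2); pose e i w := q - cos (2 * t * Y i w).
have q1 : 0 <= q <= 1 by rewrite expR_ge0 expR_le1 oppr_le0 sqr_ge0.
have me i : measurable_fun setT (e i).
  by apply: measurable_funB => //; apply: mcos; exact: measurable_funM.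
have ebound i w : `|e i w| <= 2.
  have := cos_geN1 (2 * t * Y i w); have := cos_le1 (2 * t * Y i w).
  by rewrite ler_norml /e; lra.
have Iee i : exists2 v : R, v <= 4 & has_integral P (fun w => e i w * e i w) v.
  have ee w : `|e i w * e i w| <= 4.
    rewrite normrM (_ : 4 = 2 * 2 :> R); last by ring.
    exact: ler_pM.
  have Ie : P.-integrable setT (EFin \o (fun w => e i w * e i w)).
    by apply: integrable_bounded ee; exact: measurable_funM.
  have Iv : has_integral P (fun w => e i w * e i w)
      (fine (\int[P]_w (e i w * e i w)%:E)%E).
    by split => //; rewrite fineK//; exact: integrable_fin_num.
  exists (fine (\int[P]_w (e i w * e i w)%:E)%E) => //.
  by apply: (has_integral_le Iv (has_integral_cst 4)) => w; exact: le_trans (ler_norm _) _.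
have [v v4 Iv] : exists2 v : nat -> R, forall i, v i <= 4 &
    forall i, has_integral P (fun w => e i w * e i w) (v i).
  have /choice[v Hv] : forall i, exists v : R, v <= 4 /\
      has_integral P (fun w => e i w * e i w) v.
    by move=> i; have [v ? ?] := Iee i; exists v.
  by exists v => i; have [] := Hv i.
pose c : R := (2 * t ^+ 2)^-1.
pose vv k l := if k == l then v k else 0.
have Ikl k l : has_integral P (fun w => e k w * e l w) (vv k l).
  by rewrite /vv; case: eqVneq => [->|kl]; [exact: Iv|exact: has_integral_centered_mul].
have Isum := has_integralZ (c ^+ 2) (has_integral_sum (n := M) (fun k _ =>
   has_integral_sum (n := M) (fun l _ => Ikl k l))).
exists (c ^+ 2 * \sum_(k < M) \sum_(l < M) vv k l).
  have t4 : 0 < t ^+ 4 by rewrite exprn_even_gt0.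
  have -> : M%:R / t ^+ 4 = c ^+ 2 * (M%:R * 4) by rewrite /c; field.
  apply: ler_wpM2l; first exact: sqr_ge0.
  rewrite mulr_natl -[X in _ *+ X]card_ord -sumr_const; apply: ler_sum => k _.
  rewrite (bigD1 k)//= big1 ?addr0 /vv ?eqxx// => l lk.
  by rewrite ifN// eq_sym; apply: contra lk => /eqP/val_inj ->.
apply: has_integral_eq Isum _ erefl; apply/funext => w.
have -> : \sum_(k < M) (sinc2 t (Y k w) - sinc2_mean t) = c * \sum_(k < M) e k w.
  rewrite mulr_sumr; apply: eq_bigr => k _; rewrite sinc2E// /sinc2_mean /e /c /q.
  by field.
rewrite exprMn; congr (_ * _); rewrite [RHS]expr2 mulr_suml.
by apply: eq_bigr => k _; rewrite mulr_sumr.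
Qed.

Lemma sum_inverse_squares n : \sum_(j < n) (j.+1%:R ^- 2 : R) <= 2.
Proof.
have H m : \sum_(j < m.+1) (j.+1%:R ^- 2 : R) <= 2 - m.+1%:R^-1.
  elim: m => [|m IH]; first by rewrite big_ord_recr big_ord0 /= expr1n invr1; lra.
  rewrite big_ord_recr /=; apply: (le_trans (lerD IH (lexx _))).
  rewrite -[m.+2%:R]natr1; have m0 : 0 < m.+1%:R :> R by [].
  move: (m.+1%:R) m0 => x x0; have x1 : 0 < x + 1 by lra.
  rewrite -subr_ge0 (_ : _ - _ = ((x + 1) ^+ 2 * x)^-1).
    by rewrite invr_ge0 mulr_ge0 ?exprn_ge0 ?ltW.
  by field; rewrite !gt_eqF.
case: n => [|n]; first by rewrite big_ord0.
by apply: (le_trans (H n)); rewrite gerBl invr_ge0.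
Qed.

Lemma square_average_ae : {ae P, forall w, forall eta : R, 0 < eta ->
  exists N, forall n, (N <= n)%N ->
  `|\sum_(k < n) Y k w ^+ 2 - 2^-1 * n%:R| <= eta * n%:R}.
Proof.
(* With this choice the expectation of [V j] below is at most 2 / (j + 1)^2. *)
pose t j : R := j.+1%:R^-1; pose M j := (j.+1 ^ 6)%N.
have t0 j : t j != 0 by rewrite invr_eq0 pnatr_eq0.
have M0 j : 0 < (M j)%:R :> R by rewrite ltr0n expn_gt0.
(* [A] is nonnegative, so its first moment suffices; [B] is centred and enters squared. Their sum
   [V] controls both. *)
pose A j w := (M j)%:R^-1 * \sum_(k < M j) (Y k w ^+ 2 - sinc2 (t j) (Y k w)).
pose B j w := (M j)%:R^-1 * \sum_(k < M j) (sinc2 (t j) (Y k w) - sinc2_mean (t j)).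
pose V j w := A j w + B j w ^+ 2.
have A0 j w : 0 <= A j w.
  by rewrite mulr_ge0 ?invr_ge0 ?sumr_ge0// => k _; rewrite subr_ge0 sinc2_le.
have HV j : exists a : R, a <= 2 * j.+1%:R ^- 2 /\ has_integral P (V j) a.
  have /choice[v Hv] : forall k, exists v : R, v <= 2^-1 /\ has_integral P (fun w => Y k w ^+ 2) v.
    by move=> k; have [v ? ?] := has_integral_sqr k; exists v.
  have [b b1 Ib] := has_integral_centered_sum (M j) (t0 j).
  have IA := has_integralZ (M j)%:R^-1 (has_integral_sum (n := M j) (fun k _ =>
    has_integralD (Hv k).2 (has_integralZ (-1) (has_integral_sinc2 k (t0 j))))).
  have IB := has_integralZ ((M j)%:R^-1 ^+ 2) Ib.
  eexists; split; last first.
    apply: has_integral_eq (has_integralD IA IB) _ erefl; apply/funext => w.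
    rewrite /V /A /B exprMn; congr (_ * _ + _).
    by apply: eq_bigr => k _; rewrite mulN1r.
  (* Truncation costs t^2 = (j+1)^-2 and the fluctuation 1 / (M t^4) = (j+1)^(4-6): the sixth power
     makes both summable. *)
  have -> : 2 * j.+1%:R ^- 2 = (M j)%:R^-1 * ((M j)%:R * (t j) ^+ 2) +
      (M j)%:R^-1 ^+ 2 * ((M j)%:R / (t j) ^+ 4) :> R.
    rewrite /M /t natrX; have : j.+1%:R != 0 :> R by rewrite pnatr_eq0.
    by move: (j.+1%:R) => x x0; field.
  apply: lerD; (apply: ler_wpM2l; first by rewrite ?exprn_ge0 ?invr_ge0 ?ltW).
    rewrite mulr_natl -[X in _ *+ X]card_ord -sumr_const; apply: ler_sum => k _.
    have /andP[h _] := sinc2_mean_bounds (t0 j); have [h2 _] := Hv k.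
    by have := sqr_ge0 (t j); lra.
  exact: b1.
have /choice[a Ha] := HV.
have aS n : \sum_(j < n) a j <= 4.
  apply: (@le_trans _ _ (\sum_(j < n) 2 * j.+1%:R ^- 2)).
    by apply: ler_sum => j _; case: (Ha j).
  by rewrite -mulr_sumr; have := sum_inverse_squares n; lra.
have V0 j w : 0 <= V j w by rewrite addr_ge0 ?sqr_ge0.
have := summable_ae_cvg0 V0 (fun j => (Ha j).2) aS; apply: filterS => w Vw.
apply: sixth_power_interpolation.
- by apply/andP; split; lra.
- move=> m n mn; rewrite -(subnKC mn) big_split_ord/= lerDl sumr_ge0// => k _.
  exact: sqr_ge0.
move=> eta eta0; pose e := eta / 3; have e0 : 0 < e by rewrite divr_gt0.
(* V <= e bounds [A] and V <= e^2 bounds |B|; the third error e is the bias of [sinc2_mean]. *)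
have e20 : 0 < Num.min e (e ^+ 2) by rewrite lt_min e0 exprn_gt0.
have [J HJ] := Vw _ e20.
have [K HK] : exists K : nat, e^-1 <= K%:R.
  by exists (Num.truncn e^-1).+1; rewrite ltW// real_truncnS_gt// num_real.
exists (J + K)%N => j JKj; have := HJ j (leq_trans (leq_addr _ _) JKj).
rewrite le_min => /andP[V1 V2]; rewrite -/(M j).
have Ae : A j w <= e by apply: le_trans V1; rewrite lerDl sqr_ge0.
have Be : `|B j w| <= e.
  rewrite -(ler_pXn2r (n := 2)) ?nnegrE ?(ltW e0)// real_normK ?num_real//.
  by apply: le_trans V2; rewrite lerDr.
have te : t j ^+ 2 <= e.
  have t1 : t j <= e.
    rewrite /t -[leRHS]invrK lef_pV2 ?posrE ?invr_gt0//; apply: (le_trans HK).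
    by rewrite ler_nat (leq_trans (leq_addl _ _) (leqW JKj)).
  apply: le_trans t1; rewrite expr2 ler_piMl// /t ?invr_ge0// invf_le1 ?ltr0n//.
  by rewrite ler1n.
have mb := sinc2_mean_bounds (t0 j).
have -> : \sum_(k < M j) Y k w ^+ 2 - 2^-1 * (M j)%:R =
    (A j w + B j w + (sinc2_mean (t j) - 2^-1)) * (M j)%:R.
  have -> : \sum_(k < M j) Y k w ^+ 2 = \sum_(k < M j) (Y k w ^+ 2 - sinc2 (t j) (Y k w)) +
     \sum_(k < M j) (sinc2 (t j) (Y k w) - sinc2_mean (t j)) + (M j)%:R * sinc2_mean (t j).
    rewrite -big_split/= mulr_natl -[X in _ *+ X]card_ord -sumr_const -big_split/=.
    by apply: eq_bigr => k _; ring.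
  by rewrite /A /B; field; rewrite gt_eqF.
rewrite normrM [`|(M j)%:R|]ger0_norm ?(ltW (M0 j))//.
apply: ler_wpM2r; first exact: ltW.
move: Be mb; rewrite !ler_norml => /andP[? ?] /andP[? ?].
have := A0 j w; rewrite (_ : eta = 3 * e); last by rewrite /e; field.
by move=> ?; apply/andP; split; lra.
Qed.

End square_averages.

(** * White noise *)

Section white_noise.
Context (R : realType) d (T : measurableType d) (P : probability T R).
Variable W : T -> tempered_distribution R.
Hypothesis hW : complex_white_noise P W.
Local Notation normc := Normc.normc.
Local Notation Re := complex.Re.
Local Notation Im := complex.Im.
Local Notation mu := (@lebesgue_measure R).

Lemma L2norm_sq (f : R -> R[i]) (v : R) :
  has_integral mu (fun t => normc (f t) ^+ 2) v -> L2norm f ^+ 2 = v.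
Proof.
move=> [If fv]; rewrite /L2norm Lnorm.unlock.
have -> : (\int[mu]_t `|(normc (f t))%:E| `^ 2 = v%:E)%E.
  rewrite -fv; apply: eq_integral => t _ /=.
  by rewrite ger0_norm ?normc_ge0// powR_mulrn ?normc_ge0.
have v0 : 0 <= v.
  by rewrite -lee_fin -fv; apply: integral_ge0 => t _; rewrite lee_fin sqr_ge0.
by rewrite poweR_EFin/= -powR_mulrn ?powR_ge0// -powRrM mulVf// powRr1.
Qed.

Lemma hermite_packet00 k : hermite_packet hermite k 0 0 = hermitec k :> (R -> R[i]).
Proof.
apply/funext => t; rewrite /hermite_packet /hermitec subr0 mulr0 mul0r oppr0.
by rewrite /expi cos0 sin0 mulr1.
Qed.

Lemma hermitec_schwartz k : schwartz (hermitec k : R -> R[i]).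
Proof.
by rewrite -hermite_packet00; exact: hermite_packet_schwartz (hermite_systemP R) k 0 0.
Qed.

(** The real part of the characteristic functional. Boundedness of the cosine guarantees that [fine]
    in [cexpectation] loses nothing. *)
Lemma integral_cos_white_noise (f : R -> R[i]) v : schwartz f ->
  has_integral mu (fun t => normc (f t) ^+ 2) v ->
  (\int[P]_w (cos (Re (W w f)))%:E = (expR (- (4^-1 * v)))%:E)%E.
Proof.
move=> sf fv; have [mRe mIm] := hW sf; rewrite (L2norm_sq fv) /cexpectation.
move=> /(congr1 (fun z : R[i] => Re z)) e.
have {}e : fine ('E_P[(fun w => cos (Re (W w f)))])%E = expR (- (4^-1 * v)) := e.
have mc : measurable_fun setT (fun w => cos (Re (W w f))).
  by apply: measurableT_comp => //; apply: continuous_measurable_fun; exact: continuous_cos.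
rewrite -e expectation.unlock fineK//; apply: (integrable_fin_num measurableT).
apply: (@integrable_bounded _ _ _ P _ 1) => // w.
by rewrite ler_norml cos_geN1 cos_le1.
Qed.

(** Complex linearity moves the coefficients into the test function z h_k + z' h_l, whose squared
    norm is |z|^2 + |z'|^2 by orthonormality. *)
Lemma integral_cos_hermite (z z' : R[i]) k l (a : R) : k != l ->
  normc z ^+ 2 + normc z' ^+ 2 = a ->
  (\int[P]_w (cos (Re (z * W w (hermitec k) + z' * W w (hermitec l))))%:E =
    (expR (- (a / 4)))%:E)%E.
Proof.
move=> kl <-.
have sk := hermitec_schwartz k; have sl := hermitec_schwartz l.
have szl := schwartz_scale z' sl.
have E w : z * W w (hermitec k) + z' * W w (hermitec l) =
    W w (fun t => z * hermitec k t + z' * hermitec l t).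
  by rewrite (pairing_linear (W w) z sk szl) pairing_scale.
under eq_integral do rewrite E.
rewrite mulrC; apply: integral_cos_white_noise; first exact: schwartz_lin.
have H i j : has_integral mu (fun t => hermite i t * hermite j t) (i == j)%:R.
  exact: has_integral_hermiteM (hermite_systemP R) i j.
move: (H k k) (H l l) (H k l); rewrite !eqxx (negPf kl) => Hk Hl Hkl.
have := has_integralD (has_integralZ (normc z ^+ 2) Hk)
  (has_integralD (has_integralZ (normc z' ^+ 2) Hl)
    (has_integralZ (2 * (Re z * Re z' + Im z * Im z')) Hkl)).
rewrite !mulr1 mulr0 addr0; congr has_integral; apply/funext => t.
rewrite !normcE2 !(ReD, ImD, ReM, ImM) /hermitec /=.
by move: (hermite k t) (hermite l t) => x y; ring.
Qed.

(** The unit c treats both components together: c = 1 selects the real part and c = -i the imaginary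
    part. *)
Lemma hermite_square_average (c : R[i]) : normc c = 1 ->
  {ae P, forall w, forall eta : R, 0 < eta -> exists N, forall n, (N <= n)%N ->
   `|\sum_(k < n) Re (c * W w (hermitec k)) ^+ 2 - 2^-1 * n%:R| <= eta * n%:R}.
Proof.
move=> c1.
apply: (@square_average_ae _ _ _ P (fun k w => Re (c * W w (hermitec k)))).
- move=> k; have [m _ _] := hW (schwartz_scale c (hermitec_schwartz k)).
  rewrite (_ : (fun w => _) = fun w => Re (W w (fun t => c * hermitec k t)))//.
  by apply/funext => w; rewrite pairing_scale//; exact: hermitec_schwartz.
(* For a single variable the second coefficient is 0; [k.+1] is merely an index different from k. *)
- move=> k a; have kk : k != k.+1 by rewrite ltn_eqF.
  rewrite -(@integral_cos_hermite (a%:C * c) 0 k k.+1 (a ^+ 2) kk).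
    apply: eq_integral => w _; congr (cos _)%:E.
    by rewrite mul0r addr0 -[a%:C * c * _]mulrA [RHS]ReM /= mul0r subr0.
  by rewrite Normc.normcM c1 normc_real Normc.normc0 mulr1 expr0n addr0 real_normK ?num_real.
- move=> k l a kl; rewrite (_ : a ^+ 2 / 2 = (a ^+ 2 + a ^+ 2) / 4); last by field.
  rewrite -(@integral_cos_hermite (a%:C * c) (a%:C * c) k l _ kl).
    apply: eq_integral => w _; congr (cos _)%:E.
    by rewrite -!mulrA -mulrDr [RHS]ReM /= mul0r subr0 ReD.
  by rewrite Normc.normcM c1 normc_real mulr1 real_normK ?num_real.
- move=> k l a kl; rewrite (_ : a ^+ 2 / 2 = (a ^+ 2 + a ^+ 2) / 4); last by field.
  rewrite -(@integral_cos_hermite (a%:C * c) (- (a%:C * c)) k l _ kl).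
    apply: eq_integral => w _; congr (cos _)%:E.
    by rewrite mulNr -!mulrA -mulrBr [RHS]ReM /= mul0r subr0 ReD ReN.
  by rewrite normcN Normc.normcM c1 normc_real mulr1 real_normK ?num_real.
Qed.

Lemma stft_hermitec k (u : tempered_distribution R) (x xi : R) :
  stft (hermitec k) u x xi = u (hermite_packet hermite k x xi).
Proof.
rewrite /stft; congr (u _); apply/funext => t.
by rewrite /hermite_packet /hermitec; congr (_ * _); exact: conjc_real.
Qed.

Lemma hermite_energy_average : {ae P, forall w, forall eta : R, 0 < eta ->
  exists N, forall n, (N <= n)%N ->
  `|\sum_(k < n) normc (W w (hermite_packet hermite k 0 0)) ^+ 2 - n%:R| <= eta * n%:R}.
Proof.
have n1 : normc (1 : R[i]) = 1 by exact: Normc.normc1.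
have ni : normc (- 'i : R[i]) = 1.
  by rewrite normcN /= expr0n expr1n add0r sqrtr1.
have := hermite_square_average ni; have := hermite_square_average n1.
apply: filterS2 => w H1 H2 eta eta0; have e2 : 0 < eta / 2 by rewrite divr_gt0.
have [N1 HN1] := H1 _ e2; have [N2 HN2] := H2 _ e2.
exists (N1 + N2)%N => n nN.
have := HN1 n (leq_trans (leq_addr _ _) nN); have := HN2 n (leq_trans (leq_addl _ _) nN).
have -> : \sum_(k < n) normc (W w (hermite_packet hermite k 0 0)) ^+ 2 =
   \sum_(k < n) Re (1 * W w (hermitec k)) ^+ 2 +
   \sum_(k < n) Re (- 'i * W w (hermitec k)) ^+ 2.
  rewrite -big_split/=; apply: eq_bigr => k _.
  rewrite hermite_packet00 mul1r ReM /= oppr0 mul0r sub0r mulN1r opprK.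
  exact: normcE2.
rewrite !ler_norml => /andP[? ?] /andP[? ?].
by apply/andP; split; lra.
Qed.

End white_noise.

(** * Bounded parameters and the conclusion *)

Lemma complex_compact_bounded (R : realType) (K : set R[i]^o) : compact K ->
  exists2 rho : R, 0 <= rho & forall z, K z ->
    `|complex.Re z| <= rho /\ `|complex.Im z| <= rho.
Proof.
rewrite compact_cover => Kco.
have covK : K `<=` \bigcup_(n : nat) [set z | Normc.normc z < n%:R].
  move=> z _; exists (Num.truncn (Normc.normc z)).+1 => //=.
  by rewrite real_truncnS_gt// num_real.
have /Kco [] := covK.
  move=> n _; rewrite openE => z /=; rewrite -subr_gt0 => zn.
  (* The norm of [R[i]^o] takes values in [R[i]], so the radius is a real number embedded there. *)
  apply/nbhs_ballP; exists (n%:R - Normc.normc z)%:C => /=; first by rewrite ltcR.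
  move=> q; rewrite -ball_normE /= ltcR => h.
  have {}h : Normc.normc (z - q) < n%:R - Normc.normc z := h.
  rewrite -[q](subrK z) (le_lt_trans (le_normcD _ _))// -ltrBrDr.
  by rewrite -normcN opprB.
move=> D _ DK; exists (\big[Num.max/0]_(i <- finmap.enum_fset D) i%:R).
  by elim/big_ind: _ => // x y x0 y0; rewrite le_max x0.
move=> z /DK[n Dn /= zn].
have nr : n%:R <= \big[Num.max/0]_(i <- finmap.enum_fset D) i%:R :> R.
  exact: (@le_bigmax_seq _ _ _ _ _ n xpredT (fun i : nat => i%:R) Dn isT).
by split; apply: le_trans (ltW (lt_le_trans zn nr)); [exact: normc_Re|exact: normc_Im].
Qed.

(* R[i]^o is R[i] with the topology given by the modulus. *)
Theorem theorem8p2 (R : realType) (d : measure_display) (T : measurableType d)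
    (P : probability T R) (W : T -> tempered_distribution R)
    (hW : complex_white_noise P W)
    (K : set R[i]^o) (hK : compact K) :
  {ae P, forall w,
    {uniform K,
      (fun (N : nat) (z : R[i]^o) =>
         N%:R^-1 * \sum_(k < N) spectrogram (hermitec k) (W w) z) @ \oo
      --> (fun _ : R[i]^o => 1 : R)}}.
Proof.
have [rho rho0 Krho] := complex_compact_bounded hK.
have := hermite_energy_average hW; apply: filterS => w Hw.
have U := stft_energy_average_uniform (hermite_systemP R) rho0 Hw.
move=> Q /uniform_nbhs[E [+ subQ]].
rewrite -entourage_ballE => -[e /= e0 ballE].
(* Half of e turns the non-strict bound into membership in an open ball. *)
have [|N HN] := U (e / 2); first by rewrite divr_gt0.
(* [N.+1] excludes n = 0, where the inverse takes its default value 0. *)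
exists N.+1 => // n /= Nn; apply: subQ => z Kz; apply: ballE => /=.
have n0 : 0 < n%:R :> R by rewrite ltr0n (leq_trans _ Nn).
have [zr zi] := Krho z Kz.
have h := HN n _ _ (ltnW Nn) zr zi.
rewrite -ball_normE /= distrC.
have -> : n%:R^-1 * \sum_(k < n) spectrogram (hermitec k) (W w) z - 1 = n%:R^-1 *
  (\sum_(k < n) Normc.normc (W w (hermite_packet hermite k (complex.Re z) (complex.Im z))) ^+ 2
    - n%:R).
  rewrite mulrBr mulVf ?gt_eqF//; congr (_ * _ - _); apply: eq_bigr => k _.
  by rewrite /spectrogram stft_hermitec.
rewrite normrM gtr0_norm ?invr_gt0// ltr_pdivrMl//.
by apply: (le_lt_trans h); rewrite mulrC ltr_pM2l// ltr_pdivrMr// ltr_pMr// ltr1n.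
Qed.
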